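(* Let $d\ge 1$, $R\in SO(d+1)$, $\psi\in\mathbb{R}^{d+1}\setminus S^d$ and $\phi\in\overline{\mathbb{R}}^{d+1}$. If $Y\sim C_d^*(\phi)$, then $$\mathcal{M}_{R,\psi}(Y)\sim C_d^*\{\mathcal{M}_{R,\psi}(\phi)\}.$$
   Context: $S^d=\{x\in\mathbb{R}^{d+1}:\|x\|=1\}$ with $\|\cdot\|$ the Euclidean norm; $\overline{\mathbb{R}}^{d+1}=\mathbb{R}^{d+1}\cup\{\infty\}$; $SO(d+1)$ is the group of $(d+1)\times(d+1)$ rotation matrices. Spherical Cauchy distribution: for $\phi\in\mathbb{R}^{d+1}\setminus S^d$, $Y\sim C_d^*(\phi)$ means that the $S^d$-valued random vector $Y$ has density, with respect to surface area on $S^d$, $$f(y;\phi)=\frac{\Gamma\{(d+1)/2\}}{2\pi^{(d+1)/2}}\left(\frac{|1-\|\phi\|^2|}{\|y-\phi\|^2}\right)^d,\quad y\in S^d.$$ For $\phi\in S^d$, $C_d^*(\phi)$ is the point mass at $y=\phi$; for $\phi=\infty$, $C_d^*(\infty)$ is the uniform distribution on $S^d$. Möbius transformation: for $R\in SO(d+1)$ and $\psi\in\mathbb{R}^{d+1}\setminus S^d$, $\mathcal{M}_{R,\psi}:\overline{\mathbb{R}}^{d+1}\to\overline{\mathbb{R}}^{d+1}$ is defined by $$\mathcal{M}_{R,\psi}(x)=R\left\{\frac{1-\|\psi\|^2}{\|\tilde x+\psi\|^2}(\tilde x+\psi)+\psi\right\},\quad \tilde x=x/\|x\|^2,\quad x\in\mathbb{R}^{d+1}\setminus\{0,-\psi/\|\psi\|^2\},$$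 together with $\mathcal{M}_{R,\psi}(0)=R\psi$, $\mathcal{M}_{R,\psi}(-\psi/\|\psi\|^2)=\infty$ and $\mathcal{M}_{R,\psi}(\infty)=R\psi/\|\psi\|^2$ (when $\psi=0$, $0/\|0\|^2$ is read as $\infty$, so that $\mathcal{M}_{R,0}(x)=Rx$ and $\mathcal{M}_{R,0}(\infty)=\infty$). It maps $S^d$ onto itself. *)

(* Defs.v *)
From HB Require Import structures.
From mathcomp Require Import all_boot all_order all_algebra.
From mathcomp Require Import all_classical all_reals all_analysis.

Set Implicit Arguments.
Unset Strict Implicit.
Unset Printing Implicit Defensive.

Import Order.TTheory GRing.Theory Num.Theory.
Import numFieldNormedType.Exports.

Local Open Scope classical_set_scope.
Local Open Scope ring_scope.

Section measurable_colvec.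
Context {d : measure_display} {T : measurableType d} (n : nat).

Let coor : 'I_n -> 'cV[T]_n -> T := fun i v => v i ord0.

Let colvec_set0 : g_sigma_preimage coor set0.
Proof. exact: sigma_algebra0. Qed.

Let colvec_setC A : g_sigma_preimage coor A -> g_sigma_preimage coor (~` A).
Proof. exact: sigma_algebraC. Qed.

Let colvec_bigcup (F : _^nat) : (forall i, g_sigma_preimage coor (F i)) ->
  g_sigma_preimage coor (\bigcup_i (F i)).
Proof. exact: sigma_algebra_bigcup. Qed.

(* Column vectors carry the sigma-algebra generated by the coordinates, as
   tuples do in the library; on 'cV[R]_n this is the Borel sigma-algebra. *)
HB.instance Definition _ := @isMeasurable.Build (measure_tuple_display d)
  'cV[T]_n (g_sigma_preimage coor) colvec_set0 colvec_setC colvec_bigcup.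

End measurable_colvec.

(* Euclidean norm; the library norm `|x| on matrices is the sup norm. *)
Definition enorm (R : realType) (n : nat) (x : 'cV[R]_n) : R :=
  Num.sqrt (\sum_(i < n) x i ord0 ^+ 2).

Definition sphere (R : realType) (d : nat) : set 'cV[R]_d.+1 :=
  [set x | enorm x = 1].

Definition rotation (R : realType) (n : nat) (Q : 'M[R]_n) : Prop :=
  Q^T *m Q = 1%:M /\ \det Q = 1.

(* In all that follows, the extended space R^n + {infinity} is
   option 'cV[R]_n, the point at infinity being None. *)

(* x / |x|^2, with 0 / |0|^2 read as infinity *)
Definition einv (R : realType) (n : nat) (x : 'cV[R]_n) : option 'cV[R]_n :=
  if x == 0 then None else Some ((enorm x ^+ 2)^-1 *: x).

Definition mobius (R : realType) (n : nat) (Q : 'M[R]_n) (psi : 'cV[R]_n)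
    (x : option 'cV[R]_n) : option 'cV[R]_n :=
  match x with
  | None => omap (mulmx Q) (einv psi)
  | Some x =>
      if x == 0 then Some (Q *m psi)
      else if Some x == einv (- psi) then None
      else let xt := (enorm x ^+ 2)^-1 *: x in
        Some (Q *m (((1 - enorm psi ^+ 2) / enorm (xt + psi) ^+ 2)
                      *: (xt + psi) + psi))
  end.

(* n-dimensional Lebesgue measure, as an iterated product *)
Fixpoint lebesgue_colvec (R : realType) (n : nat) : set 'cV[R]_n -> \bar R :=
  match n with
  | 0 => \d_(0 : 'cV[R]_0)
  | m.+1 => pushforward (@lebesgue_measure R \x @lebesgue_colvec R m)%E
      (fun p : R * 'cV[R]_m => col_mx (p.1)%:M p.2 : 'cV[R]_(1 + m))
  end.

(* Surface area on the unit sphere of R^(d+1), as a set function on R^(d+1)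
   that only sees the trace of A on the sphere: d+1 times the volume of the
   cone {t y | 0 < t <= 1, y in A, |y| = 1}. *)
Definition surface (R : realType) (d : nat) (A : set 'cV[R]_d.+1) : \bar R :=
  ((d.+1)%:R%:E * lebesgue_colvec
     [set x | 0 < enorm x <= 1 /\ A ((enorm x)^-1 *: x)]%R)%E.

Definition Gamma (R : realType) (s : R) : R :=
  \int[@lebesgue_measure R]_(t in `]0, +oo[) (t `^ (s - 1) * expR (- t)).

Definition cauchy_density (R : realType) (d : nat) (phi y : 'cV[R]_d.+1) : R :=
  Gamma ((d.+1)%:R / 2) / (2 * pi `^ ((d.+1)%:R / 2)) *
  (`|1 - enorm phi ^+ 2| / enorm (y - phi) ^+ 2) ^+ d.

Definition spherical_cauchy (R : realType) (d : nat)
    (phi : option 'cV[R]_d.+1) (A : set 'cV[R]_d.+1) : \bar R :=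
  match phi with
  | None => (surface A * (fine (surface (@sphere R d)))^-1%:E)%E
  | Some phi =>
      if enorm phi == 1 then \d_phi A
      else (\int[@surface R d]_(y in A) (cauchy_density phi y)%:E)%E
  end.

(* Y, a map to the extended space, is a sphere-valued random vector with law
   spherical_cauchy phi. *)
Definition follows_spherical_cauchy (R : realType) (d : nat)
    (dO : measure_display) (Omega : measurableType dO) (P : probability Omega R)
    (Y : Omega -> option 'cV[R]_d.+1) (phi : option 'cV[R]_d.+1) : Prop :=
  exists X : {RV P >-> 'cV[R]_d.+1},
    [/\ forall w, Y w = Some (X w),
        forall w, sphere (X w) &
        forall A : set 'cV[R]_d.+1, measurable A ->
          distribution P X A = spherical_cauchy phi A].

(* Main.v *)
(* Parametrize the light cone of R^(d+1,1) by x |-> (x, |x|), x in R^(d+1).  The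
   measure dx / |x| is invariant under rotations and under boosts: a boost in the
   direction e_1 changes only the first coordinate of x, so that its invariance
   is a one-dimensional substitution.  A boost multiplies |x| by a factor rho
   depending only on x / |x|, and acts on the directions x / |x| as a Moebius map
   M of the sphere.  In polar coordinates the invariance therefore says that M
   carries rho^(-d) times surface area to surface area, and the theorem reduces
   to the algebraic identity k(y, phi) rho(y) = k(M y, M phi) for the kernel
   k(y, phi) = |1 - |phi|^2| / |y - phi|^2, with k(y, oo) = 1.  Since the Cauchy
   density contains the explicit constant Gamma((d+1)/2) / (2 pi^((d+1)/2)) and
   the uniform law does not, the case where phi or M phi is infinite also needs
   the area of the sphere, computed from the Gaussian integral. *)

(* No Jacobian determinant occurs. Translations, orthogonal maps, dilations and boosts are the only
   linear or nonlinear substitutions in several variables apart from radial ones, and each is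
   reduced to Fubini, a computation on the line and a uniqueness theorem for measures. Unknown
   constants are fixed by test sets of known or invariant volume. The exponent of rho comes from a
   power count. A boost pulls the punctured unit ball back to the set rho(x / |x|) |x| <= 1;
   returning to the ball by a radial map costs rho^(d+1), and the density 1 / |x| takes back one
   factor. For |psi| > 1 the number 1 - |psi|^2 is negative. Dividing by its absolute value makes
   the boost of x a positive multiple of M(x / |x|) in this case too. All maps are total on R^(d+1)
   and have no meaning off the sphere, so positivity of rho and equality of integrands are only
   asked for on unit vectors. For phi on the sphere there is no density, and the point mass is
   transported directly. *)
Require Import Defs.
From HB Require Import structures.
From mathcomp Require Import all_boot all_order all_algebra.
From mathcomp Require Import all_classical all_reals all_analysis
  measurable_realfun.
From mathcomp Require Import ring lra.

Set Implicit Arguments.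
Unset Strict Implicit.
Unset Printing Implicit Defensive.

Import Order.TTheory GRing.Theory Num.Theory.
Import numFieldNormedType.Exports.

Local Open Scope classical_set_scope.
Local Open Scope ring_scope.

(** * Lebesgue measure on column vectors *)

Section colvec_measurability.
Context {d d' : measure_display} {T : measurableType d} {U : measurableType d'}.

Lemma measurable_coord n (i : 'I_n) :
  measurable_fun setT (fun v : 'cV[U]_n => v i ord0).
Proof.
move=> _ A mA; rewrite setTI; apply: sub_sigma_algebra => /=.
rewrite -bigcup_seq/=; exists i => /=; first by rewrite mem_index_enum.
by exists A => //; rewrite setTI.
Qed.

Lemma measurable_colvecP n (f : T -> 'cV[U]_n) :
  (forall i, measurable_fun setT (fun x => f x i ord0)) ->
  measurable_fun setT f.
Proof.
move=> mf; apply: (@measurability _ _ _ _ setT f (\big[setU/set0]_(i < n)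
   preimage_set_system setT (fun v : 'cV[U]_n => v i ord0) measurable)) => //.
move=> _ [C + <-]; rewrite -bigcup_seq => -[i _ [A mA <-]].
by rewrite [in X in _ (X)]setTI; exact: mf.
Qed.

End colvec_measurability.

Section colvec_operations.
Context {R : realType} {d : measure_display} {T : measurableType d}.
Implicit Types (n : nat).

Lemma measurable_coord_fun n (f : T -> 'cV[R]_n) i :
  measurable_fun setT f -> measurable_fun setT (fun x => f x i ord0).
Proof. by move=> mf; exact: (measurableT_comp (measurable_coord i)). Qed.

Lemma measurable_addv n (f g : T -> 'cV[R]_n) :
  measurable_fun setT f -> measurable_fun setT g ->
  measurable_fun setT (fun x => f x + g x).
Proof.
move=> mf mg; apply: measurable_colvecP => i; under eq_fun do rewrite mxE.
by apply: measurable_funD; exact: measurable_coord_fun.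
Qed.

Lemma measurable_scalev n (k : T -> R) (f : T -> 'cV[R]_n) :
  measurable_fun setT k -> measurable_fun setT f ->
  measurable_fun setT (fun x => k x *: f x).
Proof.
move=> mk mf; apply: measurable_colvecP => i; under eq_fun do rewrite mxE.
by apply: measurable_funM => //; exact: measurable_coord_fun.
Qed.

Lemma measurable_mulmx m n (A : 'M[R]_(m, n)) (f : T -> 'cV[R]_n) :
  measurable_fun setT f -> measurable_fun setT (fun x => A *m f x).
Proof.
move=> mf; apply: measurable_colvecP => i; under eq_fun do rewrite mxE.
apply: measurable_sum => j; apply: measurable_funM => //.
exact: measurable_coord_fun.
Qed.

Lemma measurable_oppv n (f : T -> 'cV[R]_n) :
  measurable_fun setT f -> measurable_fun setT (fun x => - f x).
Proof.
move=> mf; apply: measurable_colvecP => i; under eq_fun do rewrite mxE.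
exact/measurable_funN/measurable_coord_fun.
Qed.

Lemma measurable_subv n (f g : T -> 'cV[R]_n) :
  measurable_fun setT f -> measurable_fun setT g ->
  measurable_fun setT (fun x => f x - g x).
Proof. by move=> mf mg; apply: measurable_addv => //;
  exact: measurable_oppv. Qed.

Lemma measurable_invr (f : T -> R) :
  measurable_fun setT f -> measurable_fun setT (fun x => (f x)^-1).
Proof.
(* The identity 1/t = t |t|^-2 survives at t = 0, where the inverse is 0 by convention; it reduces
   inversion to the measurable power function. *)
move=> mf; rewrite (_ : (fun x => _) = (fun x => f x * `|f x| `^ (-2))).
  apply: measurable_funM => //.
  apply: (measurableT_comp (measurable_powR _)).
  exact: measurableT_comp.
apply/funext => x; rewrite -[-2]/(- 2%:R) powR_invn// real_normK ?num_real//.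
have [->|fx0] := eqVneq (f x) 0; first by rewrite invr0 mul0r.
by field.
Qed.

Lemma measurable_sqrt (f : T -> R) :
  measurable_fun setT f -> measurable_fun setT (fun x => Num.sqrt (f x)).
Proof.
move=> mf; apply: (measurableT_comp (f := @Num.sqrt R)) => //.
by apply: continuous_measurable_fun; exact: sqrt_continuous.
Qed.

Lemma measurable_enorm n (f : T -> 'cV[R]_n) :
  measurable_fun setT f -> measurable_fun setT (fun x => enorm (f x)).
Proof.
move=> mf; apply: measurable_sqrt; apply: measurable_sum => i.
exact/measurable_funX/measurable_coord_fun.
Qed.

Lemma measurable_col_mx n (f : T -> R) (g : T -> 'cV[R]_n) :
  measurable_fun setT f -> measurable_fun setT g ->
  measurable_fun setT (fun x => col_mx (f x)%:M (g x) : 'cV[R]_(1 + n)).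
Proof.
move=> mf mg; apply: measurable_colvecP => i.
case: (split_ordP i) => j ->.
  by under eq_fun do rewrite col_mxEu ord1 mxE eqxx mulr1n.
by under eq_fun do rewrite col_mxEd; exact: measurable_coord_fun.
Qed.

Lemma measurable_dsubmx n (f : T -> 'cV[R]_(1 + n)) :
  measurable_fun setT f -> measurable_fun setT (fun x => dsubmx (f x)).
Proof.
move=> mf; apply: measurable_colvecP => i; under eq_fun do rewrite mxE.
exact: measurable_coord_fun.
Qed.

End colvec_operations.

(** An image of a sigma-finite measure need not be sigma-finite. Here the left inverse [g]
    transports an exhaustion: the preimages of the [F k] under [g] cover the target and keep their
    measures. *)
Lemma pushforward_sigma_finite {d d'} {T : measurableType d}
    {U : measurableType d'} {R : realType} (m : {measure set T -> \bar R})
    (f : T -> U) (g : U -> T) :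
  sigma_finite setT m ->
  measurable_fun setT f -> measurable_fun setT g -> cancel f g ->
  {m' : {sigma_finite_measure set U -> \bar R} |
    (m' : set U -> \bar R) = pushforward m f}.
Proof.
move=> sfm mf mg fK.
pose m0 : {measure set U -> \bar R} :=
  measure_function_pushforward__canonical__measure_function_Measure m mf.
have sf : sigma_finite setT m0.
  have [F FT Foo] := sfm; exists (fun k => g @^-1` F k).
    by rewrite -preimage_bigcup -FT preimage_setT.
  move=> k; have [mF Fk] := Foo k; split.
    by rewrite -[X in measurable X]setTI; exact: mg.
  rewrite /m0/= /pushforward (_ : _ @^-1` _ = F k)//.
  by apply/seteqP; split => x /=; rewrite fK.
pose m1 : {sigma_finite_measure set U -> \bar R} :=
  HB.pack (pushforward m f) (@Measure_isSigmaFinite.Build _ _ _ m0 sf).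
by exists (m1 mf).
Qed.

Lemma sigma_finite_product {d d'} {T : measurableType d}
    {U : measurableType d'} {R : realType}
    (m1 : {sigma_finite_measure set T -> \bar R})
    (m2 : {sigma_finite_measure set U -> \bar R}) :
  sigma_finite setT (m1 \x m2)%E.
Proof.
have /sigma_finiteP[F [FT Fh Foo]] := sigma_finiteT m1.
have /sigma_finiteP[G [GT Gh Goo]] := sigma_finiteT m2.
exists (fun k => F k `*` G k).
  apply/esym; rewrite -subTset => -[x y] _.
  have : setT x by []; rewrite FT => -[i _ Fx].
  have : setT y by []; rewrite GT => -[j _ Gy].
  exists (maxn i j) => //; split => /=.
    by move: Fx; apply/subsetPset/Fh/leq_maxl.
  by move: Gy; apply/subsetPset/Gh/leq_maxr.
move=> k; have [mF Fk] := Foo k; have [mG Gk] := Goo k.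
split; first exact: measurableX.
by rewrite product_measure1E// lte_mul_pinfty// ge0_fin_numE.
Qed.

Lemma col_scalar_mx0 {R : nmodType} n (a : R) (b : 'cV[R]_n) :
  col_mx a%:M b ord0 ord0 = a.
Proof. by rewrite mxE; case: splitP => // j _; rewrite ord1 mxE eqxx mulr1n.
  Qed.

Section lebesgue_colvec_measure.
Context {R : realType}.

(** The iterated product is given as a bare set function; Tonelli's theorem needs it packaged as a
    sigma-finite measure at every stage of the recursion. *)
Lemma lebesgue_colvec_measure n :
  {m : {sigma_finite_measure set 'cV[R]_n -> \bar R} |
    (m : set _ -> \bar R) = @lebesgue_colvec R n}.
Proof.
elim: n => [|n [m mE]].
  by exists (\d_(0 : 'cV[R]_0) : {sigma_finite_measure set _ -> \bar R}).
have [||v|m' m'E] := @pushforward_sigma_finite _ _ _ 'cV[R]_(1 + n) R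
  _ (fun p : measurableTypeR R * 'cV[R]_n => col_mx (p.1)%:M p.2 : 'cV[R]_(1 +
    n))
  (fun v => (v ord0 ord0, dsubmx v)) (sigma_finite_product lebesgue_measure m).
- exact: measurable_col_mx.
- apply/measurable_fun_pairP; split => /=.
    exact: measurable_coord.
  exact: measurable_dsubmx.
- by case: v => a b /=; rewrite col_mxKd col_scalar_mx0.
by exists m'; rewrite m'E /= -mE.
Qed.

Definition leb n : {sigma_finite_measure set 'cV[R]_n -> \bar R} :=
  sval (lebesgue_colvec_measure n).

Lemma lebE n : (leb n : set _ -> \bar R) = @lebesgue_colvec R n.
Proof. exact: svalP (lebesgue_colvec_measure n). Qed.

End lebesgue_colvec_measure.

Section leb_fubini.
Context {R : realType}.
Local Notation mu := (@lebesgue_measure R).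

Definition vcons n (a : R) (z : 'cV[R]_n) : 'cV[R]_n.+1 := col_mx a%:M z.
Definition vtail n (v : 'cV[R]_n.+1) : 'cV[R]_n := dsubmx (v : 'cV[R]_(1 + n)).

Lemma vcons0 n a (z : 'cV[R]_n) : vcons a z ord0 ord0 = a.
Proof. exact: col_scalar_mx0. Qed.

Lemma vconsS n a (z : 'cV[R]_n) i : vcons a z (lift ord0 i) ord0 = z i ord0.
Proof.
rewrite -[RHS](col_mxEd (a%:M : 'cV[R]_1)) /vcons.
by congr (fun_of_matrix _ _ _); apply/val_inj.
Qed.

Lemma vconsK n (v : 'cV[R]_n.+1) : vcons (v ord0 ord0) (vtail v) = v.
Proof.
apply/colP => i; case: (unliftP ord0 i) => [j|] -> /=; last by rewrite vcons0.
by rewrite vconsS mxE; congr (v _ _); apply/val_inj.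
Qed.

Lemma vtailK n a (z : 'cV[R]_n) : vtail (vcons a z) = z.
Proof. exact: col_mxKd. Qed.

Lemma measurable_vcons {d} {T : measurableType d} n (f : T -> R)
    (g : T -> 'cV[R]_n) :
  measurable_fun setT f -> measurable_fun setT g ->
  measurable_fun setT (fun x => vcons (f x) (g x)).
Proof. exact: measurable_col_mx. Qed.

Lemma lebS n : (leb n.+1 : set _ -> \bar R) =
  pushforward (mu \x leb n)%E (fun p => vcons p.1 p.2).
Proof. by rewrite !lebE. Qed.

Section integrals.
Variables (n : nat) (F : 'cV[R]_n.+1 -> \bar R).
Hypotheses (mF : measurable_fun setT F) (F0 : forall x, (0 <= F x)%E).

Let mG : measurable_fun setT
  (fun p : measurableTypeR R * 'cV[R]_n => F (vcons p.1 p.2)).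
Proof. by apply: (measurableT_comp mF); exact: measurable_vcons. Qed.

Lemma integral_lebS :
  (\int[leb n.+1]_x F x = \int[mu]_a \int[leb n]_z F (vcons a z))%E.
Proof.
rewrite lebS ge0_integral_pushforward//; last exact: measurable_vcons.
by rewrite preimage_setT (fubini_tonelli1 (m1 := mu) (m2 := leb n) _ mG)
  => [|p /=].
Qed.

(** The order of integration for boosts along the first axis: the first coordinate moves while the
    others are frozen. *)
Lemma integral_lebS_sym :
  (\int[leb n.+1]_x F x = \int[leb n]_z \int[mu]_a F (vcons a z))%E.
Proof.
rewrite integral_lebS.
exact: (fubini_tonelli (m1 := mu) (m2 := leb n)
  (fun p => F (vcons p.1 p.2)) mG).
Qed.

End integrals.
End leb_fubini.

(** * Integral identities *)

Section integral_transfer.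
Context {d d'} {T : measurableType d} {U : measurableType d'} {R : realType}.
Local Open Scope ereal_scope.
Import HBNNSimple.

(** The hypothesis on sets says that [nu] is the image under [f] of the measure with density [w]. It
    extends to simple functions by summing over level sets, then to nonnegative [g] by monotone
    convergence. Later changes of variables are brought to this form. *)
Lemma integral_transfer (m : {measure set T -> \bar R})
    (nu : {measure set U -> \bar R}) (f : T -> U) (w : T -> R)
    (g : U -> \bar R) :
  measurable_fun setT f -> measurable_fun setT w -> (forall x, 0 <= w x)%R ->
  (forall A, measurable A -> nu A = \int[m]_(x in f @^-1` A) (w x)%:E) ->
  measurable_fun setT g -> (forall y, 0 <= g y) ->
  \int[nu]_y g y = \int[m]_x (g (f x) * (w x)%:E).
Proof.
move=> mf mw w0 nuE mg g0.
pose g_ := nnsfun_approx measurableT mg.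
have g_nd y : {homo (fun k => (g_ k y)%:E) : k l / (k <= l)%N >-> k <= l}.
  by move=> k l kl; rewrite lee_fin; exact/lefP/nd_nnsfun_approx.
have cvg_g y : (g_ k y)%:E @[k --> \oo] --> g y.
  exact: cvg_nnsfun_approx.
have mgf k : measurable_fun setT (fun x => g_ k (f x)).
  by apply: (measurableT_comp _ mf); exact: measurable_funP.
have -> : \int[nu]_y g y = limn (fun k => \int[nu]_y (g_ k y)%:E).
  rewrite -monotone_convergence//.
  - by apply: eq_integral => y _; apply/esym/cvg_lim.
  - by move=> k; exact/measurable_EFinP/measurable_funP.
  - by move=> k y _; rewrite lee_fin.
have -> : \int[m]_x (g (f x) * (w x)%:E) =
    limn (fun k => \int[m]_x ((g_ k (f x))%:E * (w x)%:E)).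
  rewrite -monotone_convergence//.
  - by apply: eq_integral => x _; apply/esym/cvg_lim => //; exact: cvgeZr.
  - by move=> k; apply/measurable_EFinP; exact: measurable_funM.
  - by move=> k x _; rewrite mule_ge0// lee_fin.
  - by move=> x _ k l kl; rewrite lee_wpmul2r ?lee_fin//; exact: g_nd.
congr (limn _); apply/funext => k.
rewrite integral_nnsfun// patch_setT sintegralE.
under [RHS]eq_integral => x _.
  rewrite (fimfunE (g_ k)) -fsumEFin// ge0_mule_fsuml; last first.
    by move=> y; exact: nnfun_muleindic_ge0.
  over.
have mA y : measurable (f @^-1` (g_ k @^-1` [set y])).
  by rewrite -[X in measurable X]setTI; apply: mf.
rewrite ge0_integral_fsum//; last 2 first.
- move=> y; apply: emeasurable_funM; last exact/measurable_EFinP.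
  apply/measurable_EFinP/measurable_funM => //.
  exact: (measurableT_comp _ mf).
- by move=> y x _; apply: mule_ge0; rewrite ?lee_fin//;
  exact: nnfun_muleindic_ge0.
apply: eq_fsbigr => y; rewrite inE => -[t _ <-].
rewrite nuE// integral_mkcond epatch_indic -ge0_integralZl//.
- by apply: eq_integral => x _ /=; rewrite EFinM -muleA [X in _ * X]muleC.
- apply: emeasurable_funM; first exact/measurable_EFinP.
  exact/measurable_EFinP.
- by move=> x _; rewrite mule_ge0// lee_fin.
by rewrite lee_fin.
Qed.

Lemma integral_eq_pushforward (m : {measure set T -> \bar R})
    (nu : {measure set U -> \bar R}) (f : T -> U) (g : U -> \bar R) :
  measurable_fun setT f ->
  (forall A, measurable A -> nu A = m (f @^-1` A)) ->
  measurable_fun setT g -> (forall y, 0 <= g y) ->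
  \int[nu]_y g y = \int[m]_x g (f x).
Proof.
move=> mf nuE mg g0; rewrite (@integral_transfer m nu f (cst 1%R))//.
  by apply: eq_integral => x _; rewrite mule1.
move=> A mA; rewrite nuE// -[LHS]mul1e -integral_cst//.
by rewrite -[X in measurable X]setTI; exact: mf.
Qed.

End integral_transfer.

(** * Translations, isometries and dilations *)

Lemma measurable_EFin_indic {d} {T : measurableType d} {R : realType}
    (A : set T) :
  measurable A -> measurable_fun setT (fun x => (\1_A x : R)%:E).
Proof. by move=> mA; exact/measurable_EFinP/measurable_indic. Qed.

Lemma measure_indic {d} {T : measurableType d} {R : realType}
    (m : {measure set T -> \bar R}) (A : set T) :
  measurable A -> m A = (\int[m]_x (\1_A x)%:E)%E.
Proof. by move=> mA; rewrite integral_indic// setIT. Qed.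

Section leb_translation.
Context {R : realType}.
Local Notation mu := (@lebesgue_measure R).
Local Open Scope ereal_scope.

Lemma integral_lebesgueD (a : R) (f : R -> \bar R) :
  measurable_fun setT f -> (forall x, 0 <= f x) ->
  \int[mu]_x f (x + a)%R = \int[mu]_x f x.
Proof.
move=> mf f0.
have mD : measurable_fun setT ((fun x => x + a)%R : measurableTypeR R ->
  measurableTypeR R).
  exact: measurable_funD.
apply/esym/(integral_eq_pushforward (m := mu) (nu := mu) mD) => // A mA.
rewrite /=; move: A mA; apply: (@lebesgue_measure_unique R
  (measure_function_pushforward__canonical__measure_function_Measure mu mD)).
move=> _ [[x y] _ <-] /=; rewrite /pushforward (_ : _ @^-1` _ = `](x - a)%R, (y
  - a)%R]%classic).
  by rewrite !lebesgue_measure_itv/= !lte_fin ltrD2r -!EFinB;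
    congr (if _ then _%:E else _); ring.
by apply/seteqP; split => z /=; rewrite !in_itv/= ltrBlDr lerBrDr.
Qed.

Lemma vconsD n a (z : 'cV[R]_n) (v : 'cV[R]_n.+1) :
  (vcons a z + v = vcons (a + v ord0 ord0) (z + vtail v))%R.
Proof.
rewrite -[in LHS](vconsK v); apply/colP => i; rewrite mxE.
by case: (unliftP ord0 i) => [j|] ->; rewrite ?vcons0 ?vconsS ?mxE.
Qed.

Lemma integral_lebD n (v : 'cV[R]_n) (F : 'cV[R]_n -> \bar R) :
  measurable_fun setT F -> (forall x, 0 <= F x) ->
  \int[leb n]_x F (x + v)%R = \int[leb n]_x F x.
Proof.
elim: n => [|n IH] in v F *; move=> mF F0.
  by apply: eq_integral => x _; congr F; apply/colP => -[].
have mshift : measurable_fun setT (fun x : 'cV[R]_n.+1 => F (x + v)%R).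
  by apply: (measurableT_comp mF); exact: measurable_addv.
rewrite (integral_lebS mshift)// (integral_lebS mF F0).
have mcons a : measurable_fun setT (fun z : 'cV[R]_n => F (vcons a z)).
  by apply: (measurableT_comp mF); exact: measurable_vcons.
rewrite -[RHS](integral_lebesgueD (v ord0 ord0)).
- apply: eq_integral => a _; rewrite -[RHS](IH (vtail v))//.
  by apply: eq_integral => z _; rewrite vconsD.
- apply: (measurable_fun_fubini_tonelli_F (m2 := leb n)
  (fun p => F (vcons p.1 p.2))) => //.
  by apply: (measurableT_comp mF); exact: measurable_vcons.
- by move=> a; exact: integral_ge0.
Qed.

(** Test sets of known volume: they bound the ball from inside and outside, calibrate dilations, and
    in the degenerate case [cube n 0 0] show that the origin is negligible in positive dimension. *)
Definition cube n (a b : R) : set 'cV[R]_n :=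
  [set v | forall i, (a <= v i ord0 <= b)%R].
Arguments cube : clear implicits.

Lemma measurable_cube n (a b : R) : measurable (cube n a b).
Proof.
rewrite (_ : cube n a b = \big[setI/setT]_(i < n)
  (fun v : 'cV[R]_n => v i ord0) @^-1` `[a, b]).
  apply: bigsetI_measurable => i _; rewrite -[X in measurable X]setTI.
  exact: measurable_coord.
apply/seteqP; split => v /=; rewrite -bigcap_seq /=.
  by move=> h i _; rewrite /= in_itv/=; exact: h.
by move=> h i; have := h i; rewrite /= in_itv/=; apply; rewrite mem_index_enum.
Qed.

Lemma leb_cube n (a b : R) : (a <= b)%R ->
  leb n (cube n a b) = ((b - a) ^+ n)%:E.
Proof.
move=> ab; elim: n => [|n IH].
  rewrite lebE /= diracE mem_set ?expr0//.
  by case.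
rewrite (measure_indic (leb n.+1) (measurable_cube a b)).
rewrite integral_lebS//; last first.
  by apply: measurable_EFin_indic; exact: measurable_cube.
rewrite (eq_integral (fun x : measurableTypeR R => (\1_(`[a, b]%classic)
  x)%:E * ((b - a) ^+ n)%:E)).
  have mI : measurable_fun setT (fun x : measurableTypeR R => (\1_(`[a,
    b]%classic) x : R)%:E).
    by apply: measurable_EFin_indic; exact: measurable_itv.
  rewrite (ge0_integralZr mu measurableT mI)//; last first.
    by rewrite lee_fin exprn_ge0// subr_ge0.
  rewrite -(measure_indic mu)//= lebesgue_measure_itv/= lte_fin exprS EFinM.
  by case: ltgtP ab => // -> _; rewrite subrr.
move=> x _; rewrite -IH (measure_indic (leb n) (measurable_cube a b)).
rewrite -ge0_integralZl//; last first.
  by apply: measurable_EFin_indic; exact: measurable_cube.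
apply: eq_integral => z _; rewrite -EFinM; congr EFin.
rewrite -[RHS]natrM mulnb !indicE; congr (_%:R); congr nat_of_bool.
apply/idP/andP => [/set_mem h|[/set_mem h1 /set_mem h2]].
  split; apply/mem_set => /=.
    by have := h ord0; rewrite vcons0 in_itv.
  by move=> i; have := h (lift ord0 i); rewrite vconsS.
apply/mem_set => i /=; case: (unliftP ord0 i) => [j|] ->;
  rewrite ?vcons0 ?vconsS.
  exact: h2.
by move: h1; rewrite /= in_itv.
Qed.

Lemma cube00 n : cube n 0 0 = [set 0%R].
Proof.
apply/seteqP; split => [x x0|x -> i]; last by rewrite mxE lexx.
by apply/colP => i; rewrite mxE; apply/eqP; rewrite eq_le andbC; exact: x0.
Qed.

Lemma measurable_set0v n : measurable [set 0%R : 'cV[R]_n].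
Proof. by rewrite -cube00; exact: measurable_cube. Qed.

Lemma leb_set0 n : leb n.+1 [set 0%R : 'cV[R]_n.+1] = 0.
Proof. by rewrite -cube00 leb_cube// subr0 expr0n. Qed.

End leb_translation.
Arguments cube {R} n a b.

Section leb_linear.
Context {R : realType} {n : nat}.
Local Open Scope ereal_scope.
Implicit Types (T : 'M[R]_n) (f g : 'cV[R]_n -> \bar R).

(* Uniqueness of Haar measure by Fubini: translate y by T x, exchange the
   integrals, translate x by - T^-1 y, and exchange them again. *)
Lemma integral_leb_linear_swap T T' f g : (T *m T' = 1%:M)%R ->
  measurable_fun setT f -> (forall x, 0 <= f x) ->
  measurable_fun setT g -> (forall x, 0 <= g x) ->
  (\int[leb n]_x f (T *m x)%R) * \int[leb n]_y g y =
  (\int[leb n]_x g (T *m x)%R) * \int[leb n]_y f (- y)%R.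
Proof.
move=> TT' mf f0 mg g0.
have mT (h : _ -> \bar R) : measurable_fun setT h -> measurable_fun setT (fun x
  => h (T *m x)%R).
  by move=> mh; apply: (measurableT_comp mh); exact: measurable_mulmx.
have mfTB : measurable_fun setT (fun p : 'cV[R]_n * 'cV[R]_n =>
    f (T *m p.1 - p.2)%R * g (T *m p.1)%R).
  apply: emeasurable_funM.
    apply: (measurableT_comp mf); apply: measurable_subv => //.
    exact: measurable_mulmx.
  by apply: (measurableT_comp mg); exact: measurable_mulmx.
have mfTD : measurable_fun setT (fun p : 'cV[R]_n * 'cV[R]_n =>
    f (T *m p.1)%R * g (p.2 + T *m p.1)%R).
  apply: emeasurable_funM.
    by apply: (measurableT_comp mf); exact: measurable_mulmx.
  apply: (measurableT_comp mg); apply: measurable_addv => //.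
  exact: measurable_mulmx.
have mgD v : measurable_fun setT (fun y : 'cV[R]_n => g (y + v)%R).
  by apply: (measurableT_comp mg); exact: measurable_addv.
have mfN v : measurable_fun setT (fun y : 'cV[R]_n => f (v - y)%R).
  by apply: (measurableT_comp mf); exact: measurable_subv.
transitivity (\int[leb n]_x \int[leb n]_y (f (T *m x)%R * g (y + T *m x)%R)).
  rewrite -(ge0_integralZr (leb n) measurableT (mT _ mf))//;
    last exact: integral_ge0.
  apply: eq_integral => x _; rewrite -(integral_lebD (T *m x) mg g0).
  by rewrite -ge0_integralZl.
rewrite (fubini_tonelli (fun p : 'cV[R]_n * 'cV[R]_n => f (T *m p.1)%R * g (p.2
  + T *m p.1)%R) mfTD); last first.
  by move=> p; rewrite mule_ge0.
transitivity (\int[leb n]_y \int[leb n]_x (f (T *m x - y)%R * g (T *m x)%R)).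
  apply: eq_integral => y _.
  rewrite -(integral_lebD (- (T' *m y))%R (F := fun x => f (T *m x)
    * g (y + T *m x)%R)).
  - apply: eq_integral => x _; rewrite mulmxBr mulmxA TT' mul1mx.
    by congr (_ * g _); rewrite addrCA addrN addr0.
  - exact: (measurableT_comp mfTD (measurable_pair2 y)).
  - by move=> x; rewrite mule_ge0.
rewrite -(fubini_tonelli (fun p : 'cV[R]_n * 'cV[R]_n => f (T *m p.1 - p.2)%R *
  g (T *m p.1)%R) mfTB); last first.
  by move=> p; rewrite mule_ge0.
rewrite -(ge0_integralZr (leb n) measurableT (mT _ mg))//;
  last exact: integral_ge0.
apply: eq_integral => x _ /=.
rewrite ge0_integralZr// muleC; congr (_ * _).
rewrite -(integral_lebD (- (T *m x))%R (F := fun y => f (- y)%R))//.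
  by apply: eq_integral => y _; rewrite opprD opprK addrC.
by apply: (measurableT_comp mf); exact: measurable_oppv.
Qed.

End leb_linear.

(** * Euclidean inner product and norm *)

Section dot_product.
Context {R : realType} {n : nat}.
Implicit Types (x y z : 'cV[R]_n) (k : R).

Definition dot x y : R := (x^T *m y) ord0 ord0.

Lemma dotC x y : dot x y = dot y x.
Proof. by rewrite /dot -[x^T *m y]trmxK mxE trmx_mul trmxK. Qed.

Lemma dotDl x y z : dot (x + y) z = dot x z + dot y z.
Proof. by rewrite /dot linearD/= mulmxDl mxE. Qed.

Lemma dotDr x y z : dot z (x + y) = dot z x + dot z y.
Proof. by rewrite dotC dotDl !(dotC z). Qed.

Lemma dotZl k x y : dot (k *: x) y = k * dot x y.
Proof. by rewrite /dot linearZ/= -scalemxAl mxE. Qed.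

Lemma dotZr k x y : dot x (k *: y) = k * dot x y.
Proof. by rewrite dotC dotZl dotC. Qed.

Lemma dotNl x y : dot (- x) y = - dot x y.
Proof. by rewrite -scaleN1r dotZl mulN1r. Qed.

Lemma dotNr x y : dot x (- y) = - dot x y.
Proof. by rewrite dotC dotNl dotC. Qed.

Lemma dot0l x : dot 0 x = 0.
Proof. by rewrite -(scale0r x) dotZl mul0r. Qed.

Lemma dot0r x : dot x 0 = 0.
Proof. by rewrite dotC dot0l. Qed.

Lemma dotE x : dot x x = \sum_i x i ord0 ^+ 2.
Proof. by rewrite /dot mxE; apply: eq_bigr => i _; rewrite mxE expr2. Qed.

Lemma dot_ge0 x : 0 <= dot x x.
Proof. by rewrite dotE sumr_ge0// => i _; rewrite sqr_ge0. Qed.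

Lemma dot_eq0 x : (dot x x == 0) = (x == 0).
Proof.
apply/idP/eqP => [|->]; last by rewrite dot0l.
rewrite dotE psumr_eq0; last by move=> i _; rewrite sqr_ge0.
move/allP => h; apply/colP => i; rewrite mxE.
by have := h i (mem_index_enum i); rewrite sqrf_eq0 => /eqP.
Qed.

Lemma enorm_sqr x : enorm x ^+ 2 = dot x x.
Proof. by rewrite dotE sqr_sqrtr// -dotE dot_ge0. Qed.

Lemma enorm_ge0 x : 0 <= enorm x.
Proof. exact: sqrtr_ge0. Qed.

Lemma enorm_eq0 x : (enorm x == 0) = (x == 0).
Proof. by rewrite -sqrf_eq0 enorm_sqr dot_eq0. Qed.

Lemma enorm_gt0 x : (0 < enorm x) = (x != 0).
Proof. by rewrite lt0r enorm_eq0 enorm_ge0 andbT. Qed.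

Lemma enormZ k x : enorm (k *: x) = `|k| * enorm x.
Proof.
apply/eqP; rewrite -(eqrXn2 (n := 2))// ?mulr_ge0 ?enorm_ge0//.
by rewrite exprMn !enorm_sqr dotZl dotZr mulrA -expr2 -normrX ger0_norm
  ?sqr_ge0.
Qed.

Lemma enorm1_dot x : (enorm x = 1) <-> (dot x x = 1).
Proof.
split => h; first by rewrite -enorm_sqr h expr1n.
by apply/eqP; rewrite -(eqrXn2 (n := 2))// ?enorm_ge0// enorm_sqr h expr1n.
Qed.

Lemma dot_mulmx (Q : 'M[R]_n) x y : Q^T *m Q = 1%:M ->
  dot (Q *m x) (Q *m y) = dot x y.
Proof. by move=> QQ; rewrite /dot trmx_mul -mulmxA (mulmxA _ Q) QQ mul1mx. Qed.

Lemma enorm_mulmx (Q : 'M[R]_n) x : Q^T *m Q = 1%:M -> enorm (Q *m x) = enorm x.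
Proof.
move=> QQ; apply/eqP; rewrite -(eqrXn2 (n := 2))// ?enorm_ge0//.
by rewrite !enorm_sqr dot_mulmx.
Qed.

End dot_product.

Section leb_invariance.
Context {R : realType} {n : nat}.
Local Open Scope ereal_scope.
Implicit Types (f : 'cV[R]_n -> \bar R) (t : R).

(** The ball serves as test set because orthogonal maps preserve it and its volume is positive and
    finite, so that it can be cancelled. *)
Definition eball : set 'cV[R]_n := [set x | (enorm x <= 1)%R].

Lemma measurable_eball : measurable eball.
Proof.
rewrite (_ : eball = (@enorm R n) @^-1` `]-oo, 1%R]%classic).
  by rewrite -[X in measurable X]setTI; apply: measurable_enorm.
by apply/seteqP; split => x /=; rewrite in_itv.
Qed.

Lemma coord_le_enorm (x : 'cV[R]_n) i : (`|x i ord0| <= enorm x)%R.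
Proof.
rewrite -(ler_pXn2r (n := 2))// ?nnegrE ?enorm_ge0//.
rewrite enorm_sqr dotE real_normK ?num_real// (bigD1 i)//= lerDl.
by rewrite sumr_ge0// => j _; rewrite sqr_ge0.
Qed.

Lemma leb_eball_lty : leb n eball < +oo.
Proof.
apply: (@le_lt_trans _ _ (leb n (cube n (-1) 1))); last first.
  by rewrite leb_cube ?ltry// lerN10.
apply: le_measure; rewrite ?inE; [exact: measurable_eball|exact:
  measurable_cube|].
move=> x /= x1 i; rewrite -ler_norml.
exact: le_trans (coord_le_enorm x i) x1.
Qed.

Lemma leb_eball_gt0 : 0 < leb n eball.
Proof.
(* The side 1/(n+1) is positive even for [n = 0]. Each squared coordinate is at most the side, so
   their sum is at most n/(n+1). *)
apply: (@lt_le_trans _ _ (leb n (cube n 0 n.+1%:R^-1))).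
  by rewrite leb_cube ?invr_ge0// subr0 lte_fin exprn_gt0// invr_gt0.
apply: le_measure; rewrite ?inE; [exact: measurable_cube|exact:
  measurable_eball|].
move=> x x1; rewrite /eball /= -(ler_pXn2r (n := 2)) ?nnegrE ?enorm_ge0//
  enorm_sqr dotE expr1n.
apply: (@le_trans _ _ (\sum_(i < n) n.+1%:R^-1)%R).
  apply: ler_sum => i _; have /andP[x0 xn] := x1 i.
  rewrite expr2 -[leRHS]mulr1; apply: ler_pM => //.
  by rewrite (le_trans xn)// invf_le1// ler1n.
by rewrite sumr_const card_ord -[(_ *+ n)%R]mulr_natl ler_pdivrMr//
  mul1r ler_nat.
Qed.

Let cancel_ball (a b : \bar R) : a * leb n eball = b * leb n eball -> a = b.
Proof.
have bf : leb n eball \is a fin_num by rewrite ge0_fin_numE// leb_eball_lty.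
move=> /(congr1 (fun z => z * (fine (leb n eball))^-1%:E)).
rewrite -!muleA -(fineK bf) -!EFinM divff ?mule1// gt_eqF//.
by rewrite fine_gt0// leb_eball_gt0 leb_eball_lty.
Qed.

#[local] Hint Resolve measurable_eball : core.

Let integral_ball (T : 'M[R]_n) : (T^T *m T = 1%:M)%R ->
  \int[leb n]_x (\1_eball (T *m x)%R)%:E = leb n eball.
Proof.
move=> TT; rewrite measure_indic//; apply: eq_integral => x _.
rewrite !indicE; congr (_%:R%:E); congr nat_of_bool.
by apply/idP/idP => /set_mem h; apply/mem_set; move: h;
  rewrite /eball/= enorm_mulmx.
Qed.

(** Taking the identity matrix in [integral_leb_linear_swap] and testing against the ball already
    gives reflection invariance, which then removes the sign from that lemma. *)
Lemma integral_lebN f : measurable_fun setT f -> (forall x, 0 <= f x) ->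
  \int[leb n]_x f (- x)%R = \int[leb n]_x f x.
Proof.
move=> mf f0; apply: cancel_ball.
have := @integral_leb_linear_swap R n 1%:M 1%:M f (EFin \o \1_eball)
  (mul1mx _) mf f0.
rewrite integral_ball ?trmx1 ?mul1mx// -measure_indic// => h.
rewrite muleC -h//; last by move=> x; rewrite lee_fin.
  by congr (_ * _); apply: eq_integral => x _; rewrite mul1mx.
exact: measurable_EFin_indic.
Qed.

(** The ratio of the integrals of f(T x) and f(x) does not depend on f. One test set then determines
    it: the ball for orthogonal maps, a cube for dilations. *)
Lemma integral_leb_linear (T T' : 'M[R]_n) f g : (T *m T' = 1%:M)%R ->
  measurable_fun setT f -> (forall x, 0 <= f x) ->
  measurable_fun setT g -> (forall x, 0 <= g x) ->
  (\int[leb n]_x f (T *m x)%R) * \int[leb n]_y g y =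
  (\int[leb n]_x g (T *m x)%R) * \int[leb n]_y f y.
Proof.
by move=> TT' mf f0 mg g0; rewrite (integral_leb_linear_swap TT')//
  integral_lebN.
Qed.

Lemma integral_leb_orthogonal (Q : 'M[R]_n) f : (Q^T *m Q = 1%:M)%R ->
  measurable_fun setT f -> (forall x, 0 <= f x) ->
  \int[leb n]_x f (Q *m x)%R = \int[leb n]_x f x.
Proof.
move=> QQ mf f0; apply: cancel_ball.
have QQ' : (Q *m Q^T = 1%:M)%R by exact: mulmx1C.
have := @integral_leb_linear Q Q^T f (EFin \o \1_eball) QQ' mf f0.
rewrite integral_ball// -measure_indic// => ->.
- by rewrite muleC.
- exact: measurable_EFin_indic.
- by move=> x; rewrite lee_fin.
Qed.

Lemma integral_lebZ t f : (0 < t)%R ->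
  measurable_fun setT f -> (forall x, 0 <= f x) ->
  (t ^+ n)%:E * \int[leb n]_x f (t *: x)%R = \int[leb n]_x f x.
Proof.
move=> t0 mf f0.
have tt : (t%:M *m t^-1%:M = 1%:M :> 'M[R]_n)%R.
  by rewrite -scalar_mxM divff ?gt_eqF.
have := integral_leb_linear tt mf f0
  (measurable_EFin_indic (R := R) (measurable_cube 0 t)).
have -> : \int[leb n]_x (\1_(cube n 0 t) x)%:E = (t ^+ n)%:E.
  rewrite -(measure_indic (leb n) (measurable_cube 0 t)).
  by rewrite /= leb_cube ?subr0 ?ltW.
under eq_integral do rewrite mul_scalar_mx.
rewrite muleC => ->; last by move=> x; rewrite lee_fin.
rewrite -[RHS]mul1e; congr (_ * _).
rewrite -[RHS](_ : leb n (cube n 0 1) = 1); last first.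
  by rewrite leb_cube// subr0 expr1n.
rewrite measure_indic; last exact: measurable_cube.
apply: eq_integral => x _; rewrite !indicE; congr (_%:R%:E); congr nat_of_bool.
apply/idP/idP => /set_mem h; apply/mem_set => i; have := h i.
  by rewrite mul_scalar_mx mxE pmulr_rge0// -ler_pdivlMl// mulVf ?gt_eqF.
by rewrite mul_scalar_mx mxE pmulr_rge0// -ler_pdivlMl// mulVf ?gt_eqF.
Qed.

End leb_invariance.

(** * Surface area and polar coordinates *)

Section surface_measure.
Context {R : realType} {d : nat}.
Local Open Scope ereal_scope.
Local Notation V := 'cV[R]_d.+1.

(** Radial projection, with the default [dir 0 = 0], a point off the sphere. *)
Definition dir (x : V) : V := ((enorm x)^-1 *: x)%R.

Lemma measurable_dir : measurable_fun setT dir.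
Proof.
apply: measurable_scalev => //; apply: measurable_invr.
exact: measurable_enorm.
Qed.

Lemma enorm_dir (x : V) : (x != 0)%R -> enorm (dir x) = 1%R.
Proof.
move=> x0; rewrite enormZ ger0_norm ?invr_ge0 ?enorm_ge0//.
by rewrite mulVf// enorm_eq0.
Qed.

Lemma dirZ (k : R) (x : V) : (0 < k)%R -> dir (k *: x)%R = dir x.
Proof.
move=> k0; rewrite /dir enormZ gtr0_norm// scalerA; congr (_ *: _)%R.
by rewrite invfM mulrAC mulVf ?gt_eqF// mul1r.
Qed.

Definition pball : set V := [set x | (0 < enorm x <= 1)%R].

Lemma measurable_pball : measurable pball.
Proof.
rewrite (_ : pball = (@enorm R d.+1) @^-1` `]0%R, 1%R]%classic).
  by rewrite -[X in measurable X]setTI; apply: measurable_enorm.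
by apply/seteqP; split => x /=; rewrite in_itv.
Qed.

Definition cone (A : set V) : set V := pball `&` dir @^-1` A.

Lemma measurable_dir_preimage A : measurable A -> measurable (dir @^-1` A).
Proof. by move=> mA; rewrite -[X in measurable X]setTI;
  exact: measurable_dir. Qed.

Lemma measurable_cone A : measurable A -> measurable (cone A).
Proof.
by move=> mA; apply: measurableI; [exact: measurable_pball|exact:
  measurable_dir_preimage].
Qed.

Lemma leb_cone_lty A : measurable A -> leb d.+1 (cone A) < +oo.
Proof.
move=> mA; apply: le_lt_trans (leb_eball_lty (n := d.+1)).
apply: le_measure; rewrite ?inE; [exact: measurable_cone|exact:
  measurable_eball|].
by move=> x [/andP[_ x1] _].
Qed.

Lemma surface_cone A : surface A = (d.+1)%:R%:E * leb d.+1 (cone A).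
Proof. by rewrite lebE. Qed.

Lemma surface_measure_ex :
  {m : {finite_measure set V -> \bar R} | (m : set V -> \bar R) = @surface R d}.
Proof.
pose m0 : {measure set V -> \bar R} :=
  mscale (NngNum (ler0n R d.+1))
    (measure_function_pushforward__canonical__measure_function_Measure
      (mrestr (leb d.+1) measurable_pball) measurable_dir).
have m0E : (m0 : set V -> \bar R) = @surface R d.
  by apply/funext => A; rewrite surface_cone /cone setIC.
have fin : fin_num_fun m0.
  move=> A mA; rewrite m0E surface_cone fin_numM// ge0_fin_numE//.
  exact: leb_cone_lty.
pose m1 : {finite_measure set V -> \bar R} :=
  HB.pack (Measure.sort m0) (@Measure_isFinite.Build _ _ _ m0 fin).
by exists m1.
Qed.

Definition surf : {finite_measure set V -> \bar R} := sval surface_measure_ex.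

Lemma surfE : (surf : set V -> \bar R) = @surface R d.
Proof. exact: svalP surface_measure_ex. Qed.

(** By its definition through cones, surface area is the image under [dir] of a multiple of volume
    on the punctured ball. This turns integrals over the sphere into volume integrals. *)
Lemma integral_surf (g : V -> \bar R) :
  measurable_fun setT g -> (forall x, 0 <= g x) ->
  \int[surf]_y g y =
  \int[leb d.+1]_x (g (dir x) * ((d.+1)%:R * \1_pball x)%:E).
Proof.
move=> mg g0; apply: integral_transfer => //.
- exact: measurable_dir.
- by apply: measurable_funM => //; apply: measurable_indic;
  exact: measurable_pball.
move=> A mA; rewrite /= surfE surface_cone (measure_indic (leb _)
  (measurable_cone mA)).
rewrite [RHS]integral_mkcond epatch_indic -ge0_integralZl//; last first.
  by apply: measurable_EFin_indic; exact: measurable_cone.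
apply: eq_integral => x _ /=; rewrite -!EFinM; congr EFin.
by rewrite /cone indicI /= mulrA.
Qed.

End surface_measure.

(** Half-lines determine half-open intervals by subtraction, whence the finiteness condition, and
    these intervals form a generating pi-system. *)
Lemma measureR_unique_cdf {R : realType}
    (m1 m2 : {measure set (measurableTypeR R) -> \bar R}) :
  (forall b, (m1 `]-oo, b]%classic < +oo)%E) ->
  (forall b, m1 `]-oo, b]%classic = m2 `]-oo, b]%classic) ->
  forall A, measurable A -> m1 A = m2 A.
Proof.
move=> m1oo m12.
have split_itv (m : {measure set (measurableTypeR R) -> \bar R}) (a b : R) :
    (a <= b)%R ->
    (m `]-oo, b]%classic = m `]-oo, a]%classic + m `]a, b]%classic)%E.
  move=> ab; rewrite -measureU//.
    by rewrite -itv_bndbnd_setU// bnd_simp.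
  apply/seteqP; split => // x [] /=; rewrite !in_itv/= => xa /andP[ax _].
  by move: ax; rewrite ltNge xa.
move=> A mA; apply: (@measure_unique _ R (measurableTypeR R) (@ocitv R)
  (fun k : nat => `](- k%:R)%R, k%:R]%classic)) => //.
- exact: ocitvI.
- by move=> k; exact: is_ocitv.
- exact: bigcup_itvT.
- move=> _ [[a b] _ <-] /=; have [ba|ab] := leP b a.
    by rewrite set_itv_ge ?bnd_simp -?leNgt// !measure0.
  have := m12 b; rewrite (split_itv m1 a b (ltW ab))
    (split_itv m2 a b (ltW ab)) m12.
  have mfin : m2 `]-oo, a]%classic \is a fin_num by rewrite -m12 ge0_fin_numE.
  by move=> /(congr1 (fun x => x - m2 `]-oo, a]%classic)%E);
    rewrite ![(m2 `]-oo, a]%classic + _)%E]addeC !addeK.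
- move=> k; apply: le_lt_trans (m1oo k%:R); apply: le_measure; rewrite ?inE//.
  by apply: subset_itvr; rewrite bnd_simp.
Qed.

(** * Independence of norm and direction *)

Section polar.
Context {R : realType} {d : nat}.
Local Open Scope ereal_scope.
Local Notation V := 'cV[R]_d.+1.
Local Notation leb := (@leb R d.+1).
Local Notation surf := (@surf R d).

Lemma measurable_dot {d'} {T : measurableType d'} {n} (f g : T -> 'cV[R]_n) :
  measurable_fun setT f -> measurable_fun setT g ->
  measurable_fun setT (fun x => dot (f x) (g x)).
Proof.
move=> mf mg; rewrite /dot; under eq_fun do rewrite mxE.
apply: measurable_sum => i; under eq_fun do rewrite mxE.
by apply: measurable_funM; exact: measurable_coord_fun.
Qed.

(** The radial coordinate is u = |x|^2 rather than |x|: the Gaussian becomes exp(-u), and the Gamma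
    integral will appear without another substitution. *)
Definition sqn (x : V) : measurableTypeR R := dot x x.

Lemma measurable_sqn : measurable_fun setT sqn.
Proof. exact: measurable_dot. Qed.

Definition fcone (A : set V) : set V := [set x | x != 0%R] `&` dir @^-1` A.

Lemma measurable_neq0 : measurable [set x : V | x != 0%R].
Proof.
rewrite (_ : mkset _ = @enorm R d.+1 @^-1` `]0%R, +oo[%classic).
  by rewrite -[X in measurable X]setTI; apply: measurable_enorm.
by apply/seteqP; split => x /=; rewrite in_itv/= andbT enorm_gt0.
Qed.

Lemma measurable_fcone A : measurable A -> measurable (fcone A).
Proof.
by move=> mA; apply: measurableI; [exact: measurable_neq0|exact:
  measurable_dir_preimage].
Qed.

Lemma measurable_sqn_preimage (B : set (measurableTypeR R)) :
  measurable B -> measurable (sqn @^-1` B).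
Proof. by move=> mB; rewrite -[X in measurable X]setTI;
  exact: measurable_sqn. Qed.

(** For b > 0 the truncated cone is [cone A] dilated by the square root of b. For b <= 0 it is
    empty, in agreement with [Num.sqrt b = 0]. *)
Lemma leb_fcone_le (A : set V) (b : R) : measurable A ->
  leb (fcone A `&` sqn @^-1` `]-oo, b]%classic) =
  (Num.sqrt b ^+ d.+1)%:E * leb (cone A).
Proof.
move=> mA; have [b0|b0] := leP b 0%R.
  rewrite ler0_sqrtr// expr0n mul0e (_ : _ `&` _ = set0) ?measure0//.
  apply/seteqP; split => // x [[/= x0 _]]; rewrite in_itv/= leNgt => /negP;
    apply.
  by rewrite (le_lt_trans b0)// lt_neqAle dot_ge0 andbT eq_sym dot_eq0.
have sb0 : (0 < Num.sqrt b)%R by rewrite sqrtr_gt0.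
have mE : measurable (fcone A `&` sqn @^-1` `]-oo, b]%classic).
  by apply: measurableI; [exact: measurable_fcone|exact:
    measurable_sqn_preimage].
rewrite (measure_indic (leb) mE) -(integral_lebZ sb0)//;
  last exact: measurable_EFin_indic.
congr (_ * _); rewrite (measure_indic _ (measurable_cone mA)).
apply: eq_integral => x _; rewrite !indicE; congr (_%:R%:E); congr nat_of_bool.
have sqE : (sqn (Num.sqrt b *: x) = b * enorm x ^+ 2)%R.
  by rewrite /sqn dotZl dotZr mulrA -expr2 sqr_sqrtr ?(ltW b0)// enorm_sqr.
have normE : (b * enorm x ^+ 2 <= b)%R = (enorm x <= 1)%R.
  by rewrite ger_pMr// -[X in (_ <= X)%R](expr1n _ 2) ler_pXn2r//
    nnegrE ?enorm_ge0.
apply/idP/idP => /set_mem h; apply/mem_set.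
  move: h => [[/=]]; rewrite scaler_eq0 gt_eqF//= dirZ// => x0 Ax.
  by rewrite in_itv/= sqE normE => x1; split => //;
    rewrite /pball/= enorm_gt0 x0.
move: h => [/andP[x0 x1] Ax]; split; first split => /=.
- by rewrite scaler_eq0 gt_eqF//= -enorm_gt0.
- by rewrite dirZ.
- by rewrite /= in_itv/= sqE normE.
Qed.

Lemma radial_measure_ex (A : set V) : measurable A ->
  {m : {measure set (measurableTypeR R) -> \bar R} |
    forall B, m B = leb (fcone A `&` sqn @^-1` B)}.
Proof.
move=> mA.
exists (measure_function_pushforward__canonical__measure_function_Measure
  (mrestr leb (measurable_fcone mA)) measurable_sqn).
by move=> B /=; rewrite /pushforward /mrestr setIC.
Qed.

Lemma surf_cone A : surf A = (d.+1)%:R%:E * leb (cone A).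
Proof. by rewrite surfE surface_cone. Qed.

(** Directions in [A] receive the same share of volume whatever range [B] is imposed on the squared
    norm. For half-lines [B] this is homogeneity, and half-lines determine a measure on the line;
    cross-multiplication avoids a quotient. *)
Lemma radial_ratio (A : set V) (B : set (measurableTypeR R)) :
  measurable A -> measurable B ->
  surf setT * leb (fcone A `&` sqn @^-1` B) =
  surf A * leb (fcone setT `&` sqn @^-1` B).
Proof.
move=> mA mB.
have sfin C : measurable C -> (fine (surf C))%:E = surf C.
  by move=> mC; rewrite fineK// fin_num_measure.
have [mrA mrAE] := radial_measure_ex mA.
have [mrT mrTE] := radial_measure_ex (@measurableT _ V).
rewrite -(sfin setT)// -(sfin A)// -mrAE -mrTE.
apply: (@measureR_unique_cdf R
  (mscale (NngNum (fine_ge0 (measure_ge0 surf setT))) mrA)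
  (mscale (NngNum (fine_ge0 (measure_ge0 surf A))) mrT)) => // b.
  change ((fine (surf setT))%:E * mrA `]-oo, b]%classic < +oo); rewrite mrAE.
  rewrite leb_fcone_le// sfin// lte_mul_pinfty// ?fin_num_measure//.
  by rewrite lte_mul_pinfty// ?lee_fin ?exprn_ge0// leb_cone_lty.
change ((fine (surf setT))%:E * mrA `]-oo, b]%classic =
  (fine (surf A))%:E * mrT `]-oo, b]%classic).
rewrite mrAE mrTE !leb_fcone_le// !sfin// !surf_cone.
by rewrite muleACA (muleC (leb (cone setT))) muleACA.
Qed.

End polar.

Section polar_product.
Context {R : realType} {d : nat}.
Local Open Scope ereal_scope.
Local Notation V := 'cV[R]_d.+1.
Local Notation leb := (@leb R d.+1).
Local Notation surf := (@surf R d).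

Lemma radial_ex : {m : {sigma_finite_measure set (measurableTypeR R)
  -> \bar R} |
  forall B, m B = leb (fcone setT `&` sqn @^-1` B)}.
Proof.
have [m mE] := radial_measure_ex (@measurableT _ V).
have sf : sigma_finite setT m.
  exists (fun k : nat => `](- k%:R)%R, k%:R]%classic).
    by rewrite bigcup_itvT.
  move=> k; split; first exact: measurable_itv.
  apply: (@le_lt_trans _ _ (m `]-oo, k%:R]%classic)).
    by apply: le_measure; rewrite ?inE//; apply: subset_itvr; rewrite bnd_simp.
  rewrite mE leb_fcone_le// lte_mul_pinfty// ?lee_fin ?exprn_ge0//.
  exact: leb_cone_lty.
(* Pushing forward along the identity only packages [m] together with its sigma-finiteness. *)
have [m1 m1E] := pushforward_sigma_finite sf (@measurable_id _ _ setT)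
  (@measurable_id _ _ setT) (fun=> erefl).
by exists m1 => B; rewrite /= m1E -mE.
Qed.

Definition radial := sval radial_ex.

Lemma radialE B : radial B = leb (fcone setT `&` sqn @^-1` B).
Proof. exact: (svalP radial_ex B). Qed.

Lemma surf_lty A : measurable A -> surf A < +oo.
Proof. by move=> mA; rewrite -ge0_fin_numE// fin_num_measure. Qed.

Lemma fine_surfK A : measurable A -> (fine (surf A))%:E = surf A.
Proof. by move=> mA; rewrite fineK// fin_num_measure. Qed.

Let phi (x : V) : measurableTypeR R * V := (sqn x, dir x).

Let mphi : measurable_fun setT phi.
Proof.
by apply/measurable_fun_pairP; split; [exact: measurable_sqn|exact:
  measurable_dir].
Qed.

Let neq0 : set V := [set x | x != 0%R].

Let mneq0 : measurable neq0. Proof. exact: measurable_neq0. Qed.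

Let radial_product (X : set (measurableTypeR R * V)) : measurable X ->
  (radial \x surf) X = surf setT * leb (phi @^-1` X `&` neq0).
Proof.
move=> mX; rewrite -(fine_surfK measurableT).
apply: (product_measure_unique (m1 := radial) (m2 := surf)
  (m' := mscale (NngNum (fine_ge0 (measure_ge0 surf setT)))
    (measure_function_pushforward__canonical__measure_function_Measure
      (mrestr leb mneq0) mphi))) => // B A mB mA.
change ((fine (surf setT))%:E * leb (phi @^-1` (B `*` A) `&` neq0) =
  radial B * surf A).
rewrite radialE muleC [RHS]muleC -radial_ratio// fine_surfK// muleC.
congr (_ * leb _); apply/seteqP; split => x [] /=.
  by move=> [Bx Ax] x0; split.
by move=> [x0 Ax] Bx; split.
Qed.

(** By [radial_ratio], [surf setT] times the image of volume under (|x|^2, x / |x|) agrees on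
    rectangles with the product of [radial] and [surf]. The factor [surf setT] is there because
    [radial] already counts all directions. *)
Lemma polar (F : measurableTypeR R * V -> \bar R) :
  measurable_fun setT F -> (forall p, 0 <= F p) ->
  surf setT * \int[leb]_x (F (sqn x, dir x) * (\1_[set x | x != 0%R] x)%:E) =
  \int[surf]_y \int[radial]_u F (u, y).
Proof.
move=> mF F0.
have mI : measurable_fun setT (fun x => (\1_neq0 x : R)%:E).
  exact: measurable_EFin_indic.
have mFphi : measurable_fun setT (fun x => F (phi x))
  by exact: measurableT_comp.
rewrite -(fubini_tonelli (m1 := radial) (m2 := surf) F mF F0).
rewrite -[RHS](fubini_tonelli1 (m1 := radial) (m2 := surf) F mF F0).
rewrite (@integral_transfer _ _ _ _ R leb _ phi
  (fun x => fine (surf setT) * \1_neq0 x)%R F)//.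
- rewrite -(fine_surfK measurableT) -ge0_integralZl//.
  + by apply: eq_integral => x _; rewrite EFinM muleCA.
  + exact: emeasurable_funM.
  + by move=> x _; rewrite mule_ge0// lee_fin.
  + by rewrite fine_surfK.
- by apply: measurable_funM => //; exact: measurable_indic.
- by move=> x; rewrite mulr_ge0// fine_ge0.
- move=> X mX; have mpX : measurable (phi @^-1` X).
    by rewrite -[X in measurable X]setTI; exact: mphi.
  rewrite [LHS]radial_product// (measure_indic _ (measurableI _ _ mpX mneq0)).
  rewrite -(fine_surfK measurableT) -ge0_integralZl//.
  + rewrite [RHS]integral_mkcond epatch_indic; apply: eq_integral => x _ /=.
    by rewrite indicI/= EFinM muleCA [RHS]muleC.
  + by apply: measurable_EFin_indic; exact: measurableI.
  + by rewrite fine_surfK.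
Qed.

End polar_product.

(** * Radial rescaling *)

Section rescaling.
Context {R : realType} {d : nat}.
Local Open Scope ereal_scope.
Local Notation V := 'cV[R]_d.+1.
Local Notation leb := (@leb R d.+1).
Local Notation surf := (@surf R d).
Local Notation radial := (@radial R d).

Lemma pball_eball : leb pball = leb (@eball R d.+1).
Proof.
have -> : @eball R d.+1 = pball `|` [set 0%R].
  apply/seteqP; split => x /=.
    move=> x1; have [->|x0] := eqVneq x 0%R; first by right.
    by left; rewrite /pball/= enorm_gt0 x0.
  by move=> [/andP[]//|->]; rewrite /eball/= (eqP (_ : enorm 0 == 0)%R)
    ?enorm_eq0.
rewrite measureU//=; first by rewrite leb_set0 adde0.
- exact: measurable_pball.
- exact: measurable_set0v.
- by apply/seteqP; split => // x [/andP[x0 _] xE]; move: x0;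
  rewrite xE enorm_gt0 eqxx.
Qed.

Lemma cone_setT : cone setT = pball :> set V.
Proof. by rewrite /cone preimage_setT setIT. Qed.

Lemma surfT_gt0 : 0 < surf setT.
Proof.
by rewrite surf_cone cone_setT pball_eball mule_gt0// leb_eball_gt0.
Qed.

Lemma surf_cancel (a b : \bar R) : surf setT * a = surf setT * b -> a = b.
Proof.
have r0 : (0 < fine (surf setT))%R by rewrite fine_gt0// surfT_gt0 surf_lty.
move: r0 (fine_surfK (@measurableT _ V)); move: (fine _) => r r0 <-.
move=> /(congr1 (fun z => r^-1%:E * z)).
by rewrite !muleA -!EFinM mulVf ?mul1e// gt_eqF.
Qed.

Lemma measurable_sphere : measurable (@sphere R d).
Proof.
rewrite (_ : @sphere R d = @enorm R d.+1 @^-1` [set 1%R])//.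
by rewrite -[X in measurable X]setTI; apply: measurable_enorm.
Qed.

Section rho.
Variables (rho : V -> R) (G : V -> \bar R).
Hypotheses (mrho : measurable_fun setT rho) (rho_ge0 : forall y, (0 <= rho
  y)%R).
Hypothesis rho_gt0 : forall y, sphere y -> (0 < rho y)%R.
Hypotheses (mG : measurable_fun setT G) (G0 : forall y, 0 <= G y).

(** For [rho] positive on the sphere, the preimage of the punctured ball under the radial map x |->
    rho(x / |x|) x. *)
Definition rescaled_ball : set V :=
  [set x | (x != 0) && (enorm x * rho (dir x) <= 1)]%R.

(** The weight in polar coordinates. The first component is a squared norm, so the condition |x| rho
    <= 1 appears squared; the indicator of the sphere discards directions where [rho] may vanish. *)
Let H (p : measurableTypeR R * V) : R :=
  (\1_(@sphere R d) p.2 *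
   (\1_[set p : measurableTypeR R * V | p.1 * rho p.2 ^+ 2 <= 1] p * rho p.2 ^+
     d.+1))%R.

Let mC : measurable [set p : measurableTypeR R * V | p.1 * rho p.2 ^+ 2 <= 1]%R.
Proof.
rewrite (_ : mkset _ = (fun p : measurableTypeR R * V => p.1 * rho p.2 ^+ 2)%R
  @^-1` `]-oo, 1%R]%classic).
  rewrite -[X in measurable X]setTI; apply: measurable_funM => //.
  by apply: measurable_funX; exact: measurableT_comp.
by apply/seteqP; split => x /=; rewrite in_itv.
Qed.

Let mH : measurable_fun setT H.
Proof.
apply: measurable_funM.
  apply: (measurableT_comp (f := (\1_(@sphere R d) : V -> R))) => //.
  exact: measurable_indic measurable_sphere.
apply: measurable_funM; first exact: measurable_indic.
by apply: measurable_funX; exact: measurableT_comp.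
Qed.

(** In a fixed direction the squared norm runs up to rho^-2, an interval of radial mass rho^-(d+1)
    times that of the unit ball; the factor rho^(d+1) in [H] cancels it. *)
Let inner (y : V) : \int[radial]_u ((H (u, y))%:E * G y) =
  leb (cone setT) * ((\1_(@sphere R d) y)%:E * G y).
Proof.
have [ys|ys] := pselect (sphere y); last first.
  rewrite indicE memNset// mul0e mule0; apply: integral0_eq => u _.
  by rewrite /H /= indicE memNset// mul0r mul0e.
have r0 := rho_gt0 ys; rewrite indicE mem_set// mul1e.
have -> : leb (cone setT) =
    (rho y ^+ d.+1)%:E * radial `]-oo, (rho y ^-2)%R]%classic.
  rewrite radialE leb_fcone_le// muleA -EFinM -exprVn sqrtr_sqr ger0_norm
    ?invr_ge0 ?rho_ge0//.
  by rewrite -exprMn divff ?gt_eqF// expr1n mul1e.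
rewrite [X in X * G y]muleC -muleA (measure_indic radial (measurable_itv _)).
rewrite -ge0_integralZr//; last 2 first.
- by apply: measurable_EFin_indic; exact: measurable_itv.
- by rewrite mule_ge0// lee_fin exprn_ge0.
apply: eq_integral => u _; rewrite /H indicE mem_set// mul1r EFinM muleA.
congr (_%:E * _ * _); rewrite !indicE; congr (_%:R); congr nat_of_bool.
have r2 : (0 < rho y ^+ 2)%R by rewrite exprn_gt0.
by apply/idP/idP => /set_mem h; apply/mem_set; move: h;
  rewrite /= in_itv/= -[(rho y ^- 2)%R]mul1r ler_pdivlMr.
Qed.

Lemma surf_rescaled : surf setT *
  \int[leb]_x ((\1_rescaled_ball x * rho (dir x) ^+ d.+1)%:E * G (dir x)) =
  leb (cone setT) * \int[surf]_y ((\1_(@sphere R d) y)%:E * G y).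
Proof.
have mSG : measurable_fun setT (fun y => (\1_(@sphere R d) y)%:E * G y).
  apply: emeasurable_funM => //.
  by apply: measurable_EFin_indic; exact: measurable_sphere.
rewrite -[RHS]ge0_integralZl//; last by move=> y _; rewrite mule_ge0// lee_fin.
under [RHS]eq_integral do rewrite -inner.
rewrite -(polar (F := fun p => (H p)%:E * G p.2)).
- congr (_ * _); apply: eq_integral => x _ /=.
  have [->|x0] := eqVneq x 0%R.
    rewrite !indicE memNset /rescaled_ball/= ?eqxx//.
    by rewrite memNset/= ?eqxx// !mul0r mul0e mule0.
  rewrite [\1_[set x | x != 0%R] x]indicE mem_set// mule1; congr (_%:E * _).
  rewrite /H [\1_(@sphere R d) _]indicE mem_set ?mul1r; last exact: enorm_dir.
  congr (_ * _)%R; rewrite !indicE; congr (_%:R); congr nat_of_bool.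
  have E : (sqn x * rho (dir x) ^+ 2 <= 1)%R = (enorm x * rho (dir x) <= 1)%R.
    rewrite /sqn -enorm_sqr -exprMn -[X in (_ <= X)%R](expr1n _ 2).
    by rewrite ler_pXn2r// nnegrE ?mulr_ge0 ?enorm_ge0.
  by apply/idP/idP => /set_mem h; apply/mem_set; move: h;
    rewrite /rescaled_ball/= E x0.
- apply: emeasurable_funM; first exact/measurable_EFinP.
  exact: measurableT_comp.
- by move=> p; rewrite mule_ge0// lee_fin !mulr_ge0// exprn_ge0.
Qed.

End rho.

(* The radial map x |-> rho(x / |x|) x has Jacobian rho(x / |x|)^(d+1). *)
Lemma integral_rescale (rho : V -> R) (G : V -> \bar R) :
  measurable_fun setT rho -> (forall y, (0 <= rho y)%R) ->
  (forall y, sphere y -> (0 < rho y)%R) ->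
  measurable_fun setT G -> (forall y, 0 <= G y) ->
  \int[leb]_x ((\1_(rescaled_ball rho) x * rho (dir x)
    ^+ d.+1)%:E * G (dir x)) =
  \int[leb]_x ((\1_pball x)%:E * G (dir x)).
Proof.
move=> mrho rho0 rho_gt0 mG G0; apply: surf_cancel; rewrite surf_rescaled//.
(* The right-hand side of [surf_rescaled] is free of [rho], so it can be compared with the case rho
   = 1. *)
rewrite -(@surf_rescaled (cst 1%R))//.
congr (_ * _); apply: eq_integral => x _; rewrite expr1n mulr1.
congr (_%:E * _); rewrite !indicE; congr (_%:R); congr nat_of_bool.
by apply/idP/idP => /set_mem h; apply/mem_set; move: h;
  rewrite /rescaled_ball/pball/= mulr1 enorm_gt0.
Qed.

End rescaling.

(** * Lorentz boosts *)

Lemma density_measure_ex {d} {T : measurableType d} {R : realType}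
    (m : {measure set T -> \bar R}) (w : T -> R) :
  measurable_fun setT w -> (forall x, 0 <= w x) ->
  {m' : {measure set T -> \bar R} |
    forall A, m' A = (\int[m]_(x in A) (w x)%:E)%E}.
Proof.
move=> mw w0.
pose k (A : set T) := (\int[m]_(x in A) (w x)%:E)%E.
have k0 : k set0 = 0%E by rewrite /k integral_set0.
have k_ge0 A : (0 <= k A)%E by apply: integral_ge0 => x _; rewrite lee_fin.
have ks : semi_sigma_additive k.
  by apply: semi_sigma_additive_nng_induced => //; exact/measurable_EFinP.
pose m' : {measure set T -> \bar R} :=
  HB.pack k (isMeasure.Build _ _ _ k k0 k_ge0 ks).
by exists m'.
Qed.

Section change_of_variables.
Context {R : realType}.
Local Notation mu := (@lebesgue_measure R).
Local Open Scope ereal_scope.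

Lemma integral_derive (f F : R -> R) (a b : R) : (a < b)%R ->
  continuous f -> (forall x : R, is_derive x 1%R F (f x)) ->
  \int[mu]_(x in `]a, b]) (f x)%:E = (F b - F a)%:E.
Proof.
move=> ab cf dF.
have cF : continuous F.
  by move=> x; apply: differentiable_continuous; apply/derivable1_diffP;
    case: (dF x).
have mf : measurable_fun setT f by exact: continuous_measurable_fun.
rewrite integral_itv_obnd_cbnd; last first.
  by apply: measurable_funTS; exact/measurable_EFinP.
rewrite (continuous_FTC2 (F := F) ab)//.
- by apply: continuous_subspaceT.
- split; first by move=> x _; case: (dF x).
  + by apply: cvg_at_right_filter; exact: cF.
  + by apply: cvg_at_left_filter; exact: cF.
- by move=> x _; rewrite derive1E; case: (dF x).
Qed.

(** By the fundamental theorem of calculus, the measure with density [h'] gives the preimage of ]a,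
    b] the mass b - a; hence its image under [h] is Lebesgue measure. *)
Lemma integral_lebesgue_comp (h hi h' : R -> R) (g : R -> \bar R) :
  cancel hi h -> cancel h hi -> {mono h : x y / (x <= y)%R} ->
  continuous h' -> (forall x, 0 <= h' x)%R ->
  (forall x : R, is_derive x 1%R h (h' x)) ->
  measurable_fun setT g -> (forall x, 0 <= g x) ->
  \int[mu]_x (g (h x) * (h' x)%:E) = \int[mu]_x g x.
Proof.
move=> hiK hK hle ch' h'0 dh mg g0.
have ch : continuous h.
  by move=> x; apply: differentiable_continuous; apply/derivable1_diffP;
    case: (dh x).
have mh : measurable_fun setT (h : measurableTypeR R -> measurableTypeR R).
  exact: continuous_measurable_fun.
have mh' : measurable_fun setT (h' : measurableTypeR R -> R).
  exact: continuous_measurable_fun.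
have [D DE] := density_measure_ex mu mh' h'0.
have E (A : set (measurableTypeR R)) : measurable A -> mu A = \int[mu]_(x in h
  @^-1` A) (h' x)%:E.
  move=> mA; rewrite -DE; move: A mA.
  apply: (@lebesgue_measure_unique R
    (measure_function_pushforward__canonical__measure_function_Measure D mh)).
  move=> _ [[a b] _ <-] /=.
  have [ba|ab] := leP b a.
    by rewrite set_itv_ge ?bnd_simp -?leNgt// measure0 /pushforward
      preimage_set0 measure0.
  rewrite lebesgue_measure_itv/= lte_fin ab /pushforward.
  have -> : h @^-1` `]a, b]%classic = `]hi a, hi b]%classic.
    apply/seteqP; split => x /=; rewrite !in_itv/= -(hle x) hiK;
      by rewrite !ltNge -(hle x) hiK.
  rewrite DE (integral_derive _ ch' dh) ?hiK ?EFinB//.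
  by rewrite ltNge -hle !hiK -ltNge.
by rewrite -(integral_transfer (m := mu) (nu := mu) mh mh' h'0 E).
Qed.

End change_of_variables.

(* Substitution x |-> c x + s sqrt(x^2 + r^2): in the coordinate
   x = r sinh u, for which dx / sqrt(x^2 + r^2) = du, it is a translation. *)
Section boost_line.
Context {R : realType}.
Local Notation mu := (@lebesgue_measure R).
Variables (c s r : R).
Hypotheses (r0 : 0 < r) (c0 : 0 < c) (cs : c ^+ 2 - s ^+ 2 = 1).

Let q (x : R) := Num.sqrt (x ^+ 2 + r ^+ 2).
Let h (x : R) := c * x + s * q x.
Let hi (x : R) := c * x - s * q x.

Let q2 x : q x ^+ 2 = x ^+ 2 + r ^+ 2.
Proof. by rewrite sqr_sqrtr// addr_ge0// sqr_ge0. Qed.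

Let r2 x : r ^+ 2 = q x ^+ 2 - x ^+ 2.
Proof. by rewrite q2 addrC addKr. Qed.

Let c2 : c ^+ 2 = 1 + s ^+ 2.
Proof. by rewrite -cs subrK. Qed.

Let q_gt0 x : 0 < q x.
Proof. by rewrite sqrtr_gt0 ltr_wpDl ?sqr_ge0 ?exprn_gt0. Qed.

Let lt_q (x : R) : `|x| < q x.
Proof.
rewrite -(ltr_pXn2r (n := 2))// ?nnegrE ?(ltW (q_gt0 x))//
  q2 real_normK ?num_real//.
by rewrite ltrDl exprn_gt0.
Qed.

Let lt_c : `|s| < c.
Proof.
rewrite -(ltr_pXn2r (n := 2))// ?nnegrE ?(ltW c0)// real_normK ?num_real//.
by rewrite -subr_gt0 cs.
Qed.

Let qD_gt0 x y : `|y| <= `|s| -> 0 < c * q x + y * x.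
Proof.
move=> ys; rewrite -ltrBlDr sub0r (le_lt_trans (ler_norm _))// normrN normrM.
apply: (@le_lt_trans _ _ (`|s| * `|x|)); first by rewrite ler_wpM2r.
apply: (@le_lt_trans _ _ (`|s| * q x)); first by rewrite ler_wpM2l// ltW.
by rewrite ltr_pM2r.
Qed.

(** The point (x, q x) lies on a branch of the hyperbola q^2 - x^2 = r^2, which the hyperbolic
    rotation with rows (c, s) and (s, c) preserves; [h] is its first component and this is the
    second. Positivity selects the branch. *)
Let qh x : q (h x) = c * q x + s * x.
Proof.
apply/eqP; rewrite -(eqrXn2 (n := 2))// ?(ltW (q_gt0 _))//
  ?(ltW (qD_gt0 _ _))//.
by rewrite q2 /h; apply/eqP; have := r2 x; move: (q x) => z zE; ring: zE c2.
Qed.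

Let qhi x : q (hi x) = c * q x - s * x.
Proof.
have h0 := @qD_gt0 x (- s); rewrite normrN lexx mulNr in h0.
apply/eqP; rewrite -(eqrXn2 (n := 2))// ?(ltW (q_gt0 _))// ?(ltW (h0 _))//.
by rewrite q2 /hi; apply/eqP; have := r2 x; move: (q x) => z zE; ring: zE c2.
Qed.

Let hK : cancel h hi.
Proof. by move=> x; rewrite /hi qh /h; move: (q x) => z; ring: c2. Qed.

Let hiK : cancel hi h.
Proof. by move=> x; rewrite /h qhi /hi; move: (q x) => z; ring: c2. Qed.

Let h_mono : {mono h : x y / x <= y}.
Proof.
move=> x y; rewrite -subr_ge0 -[RHS]subr_ge0.
have P0 : 0 < q x + q y by rewrite addr_gt0.
have Q0 : 0 < q (h x) + q (h y) by rewrite addr_gt0.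
(* After multiplication by these positive factors both sides coincide: (h y - h x)(q x + q y) = (y -
   x)(q (h x) + q (h y)). *)
rewrite -(pmulr_lge0 _ P0) -[RHS](pmulr_lge0 _ Q0); congr (_ <= _).
rewrite !qh /h; have := q2 x; have := q2 y; move: (q x) (q y) => z t.
by move=> tE zE; ring: tE zE.
Qed.

(** In this form the derivative displays the invariance of dx / q: the quotient of [h' x] by
    [q (h x)] is 1 / q x. *)
Let h' x := q (h x) / q x.

Let dh (x : R) : is_derive x 1 h (h' x).
Proof.
have -> : h' x = c + s * (x / q x).
  by rewrite /h' qh mulrDl mulfK ?gt_eqF// mulrA.
have dx2 : is_derive x (1 : R) (fun y => y ^+ 2 + r ^+ 2) (2 * x).
  by apply: is_derive_eq; rewrite addr0 /GRing.scale/= mulr1 -mulr2n mulr_natl.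
have x2r : 0 < x ^+ 2 + r ^+ 2 by rewrite -q2 exprn_gt0.
have dq : is_derive x (1 : R) q (x / q x).
  have -> : x / q x = (2 * q x)^-1 * (2 * x).
    by rewrite invfM mulrACA mulVf ?pnatr_eq0// mul1r mulrC.
  exact: (@is_derive1_comp R Num.sqrt (fun y => y ^+ 2 + r ^+ 2) x
    (2 * q x)^-1 (2 * x) (is_derive1_sqrt x2r) dx2).
by apply: is_derive_eq; rewrite /GRing.scale/= mulr1.
Qed.

Let cq : continuous q.
Proof.
move=> x; apply: (continuous_comp (f := fun y : R => y ^+ 2 + r ^+ 2)).
  by apply: continuousD; [exact: exprn_continuous|exact: cvg_cst].
exact: sqrt_continuous.
Qed.

Let ch' : continuous h'.
Proof.
move=> x; apply: cvgM.
  apply: (continuous_comp (f := h)); last exact: cq.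
  by apply: differentiable_continuous; apply/derivable1_diffP; case: (dh x).
by apply: cvgV; [rewrite gt_eqF|exact: cq].
Qed.

Lemma integral_boost_line (g : R -> \bar R) :
  measurable_fun setT g -> (forall x, 0 <= g x)%E ->
  (\int[mu]_x (g (c * x + s * Num.sqrt (x ^+ 2 + r ^+ 2))%R *
      (Num.sqrt (x ^+ 2 + r ^+ 2))^-1%:E) =
   \int[mu]_x (g x * (Num.sqrt (x ^+ 2 + r ^+ 2))^-1%:E))%E.
Proof.
move=> mg g0.
have q_ge0 x : 0 <= (q x)^-1 by rewrite invr_ge0 ltW.
rewrite -[RHS](integral_lebesgue_comp (h := h) (hi := hi) (h' := h'))//.
- apply: eq_integral => x _; rewrite -/(q x) -/(q (h x)) -/(h x) -muleA -EFinM.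
  by rewrite /h' mulrA mulVf ?mul1r// gt_eqF.
- by move=> x; rewrite mulr_ge0// ltW.
- apply: emeasurable_funM => //; apply/measurable_EFinP.
  by apply: measurable_invr; exact: continuous_measurable_fun.
- by move=> x; rewrite mule_ge0// lee_fin.
Qed.

End boost_line.

Section boost.
Context {R : realType}.
Local Open Scope ereal_scope.
Local Notation mu := (@lebesgue_measure R).

Lemma dot_sum n (x y : 'cV[R]_n) : dot x y = (\sum_i x i ord0 * y i ord0)%R.
Proof. by rewrite /dot mxE; apply: eq_bigr => i _; rewrite mxE. Qed.

Lemma dot_vcons n (a b : R) (z w : 'cV[R]_n) :
  dot (vcons a z) (vcons b w) = (a * b + dot z w)%R.
Proof.
rewrite !dot_sum big_ord_recl !vcons0; congr (_ + _)%R.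
by apply: eq_bigr => i _; rewrite !vconsS.
Qed.

Lemma enorm_vcons n (a : R) (z : 'cV[R]_n) :
  enorm (vcons a z) = Num.sqrt (a ^+ 2 + enorm z ^+ 2).
Proof.
apply/eqP; rewrite -(eqrXn2 (n := 2))// ?sqrtr_ge0 ?enorm_ge0//.
by rewrite !enorm_sqr sqr_sqrtr ?addr_ge0 ?sqr_ge0 ?dot_ge0// dot_vcons expr2.
Qed.

Lemma vconsZ n (k a : R) (z : 'cV[R]_n) : (k *: vcons a z = vcons (k * a)
  (k *: z))%R.
Proof. by rewrite /vcons -scale_scalar_mx -scale_col_mx. Qed.

Lemma vcons_add n (a b : R) (z w : 'cV[R]_n) :
  (vcons a z + vcons b w = vcons (a + b) (z + w))%R.
Proof. by rewrite vconsD vcons0 vtailK. Qed.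

(* Action on the light cone {(x, |x|)}, seen through its first component, of a
   Lorentz boost in the direction psi (followed by a reflection if |psi| > 1). *)
Definition boost n (psi x : 'cV[R]_n) : 'cV[R]_n :=
  (`|1 - dot psi psi|^-1 *:
    ((1 - dot psi psi) *: x + (2 * (enorm x + dot x psi)) *: psi))%R.

Lemma measurable_boost n (psi : 'cV[R]_n) : measurable_fun setT (boost psi).
Proof.
apply: measurable_scalev => //; apply: measurable_addv.
  exact: measurable_scalev.
apply: measurable_scalev => //; apply: measurable_funM => //.
by apply: measurable_funD; [exact: measurable_enorm|exact: measurable_dot].
Qed.

Lemma boost_vcons n (p t : R) (z : 'cV[R]_n) :
  boost (vcons p 0%R) (vcons t z) =
  vcons (`|1 - p ^+ 2|^-1 * ((1 + p ^+ 2) * t +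
     2 * p * Num.sqrt (t ^+ 2 + enorm z ^+ 2)))%R
   ((`|1 - p ^+ 2|^-1 * (1 - p ^+ 2)) *: z)%R.
Proof.
rewrite /boost !dot_vcons !dot0r !addr0 enorm_vcons -expr2.
rewrite !vconsZ vcons_add vconsZ scaler0 addr0 scalerA.
by congr vcons; congr (_ * _)%R; ring.
Qed.

(** With the remaining coordinates z frozen, the first one undergoes the substitution of
    [integral_boost_line] with r = |z|. This needs z != 0, and z ranges over a space of dimension at
    least 1, where the origin is negligible. *)
Lemma integral_boost_e1 n (p : R) (g : 'cV[R]_n.+2 -> \bar R) :
  (p ^+ 2 != 1)%R ->
  measurable_fun setT g -> (forall x, 0 <= g x) ->
  \int[leb n.+2]_x (g (boost (vcons p 0%R) x) * (enorm x)^-1%:E) =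
  \int[leb n.+2]_x (g x * (enorm x)^-1%:E).
Proof.
move=> p1 mg g0.
have inv_ge0 k (x : 'cV[R]_k) : 0 <= (enorm x)^-1%:E.
  by rewrite lee_fin invr_ge0 enorm_ge0.
have minv k : measurable_fun setT (fun x : 'cV[R]_k => (enorm x)^-1%:E).
  by apply/measurable_EFinP/measurable_invr; exact: measurable_enorm.
pose f1 (x : 'cV[R]_n.+2) := g (boost (vcons p 0%R) x) * (enorm x)^-1%:E.
pose f2 (x : 'cV[R]_n.+2) := g x * (enorm x)^-1%:E.
have f1_ge0 x : 0 <= f1 x by rewrite mule_ge0.
have f2_ge0 x : 0 <= f2 x by rewrite mule_ge0.
have mf1 : measurable_fun setT f1.
  apply: (emeasurable_funM _ (minv _)).
  exact: (measurableT_comp mg (measurable_boost _)).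
have mf2 : measurable_fun setT f2 by exact: (emeasurable_funM mg (minv _)).
have D0 : (1 - p ^+ 2 != 0)%R by rewrite subr_eq0 eq_sym.
have N0 : (0 < `|1 - p ^+ 2|)%R by rewrite normr_gt0.
have mcons (k : nat) : measurable_fun setT (fun u : measurableTypeR R *
  'cV[R]_k => vcons u.1 u.2).
  exact: measurable_vcons.
(* The sign of 1 - p^2, by which the boost multiplies the remaining coordinates; reflection
   invariance of the outer integral will absorb it. *)
pose eps := (`|1 - p ^+ 2|^-1 * (1 - p ^+ 2))%R.
have eps1 : eps = 1%R \/ eps = (-1)%R.
  rewrite /eps; case: (ltrgt0P (1 - p ^+ 2)%R) (D0) => // h _.
    by left; rewrite mulVf.
  by right; rewrite invrN mulNr mulVf.
have enorm_eps (z : 'cV[R]_n.+1) : enorm (eps *: z) = enorm z.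
  by rewrite enormZ; case: eps1 => ->; rewrite ?normrN normr1 mul1r.
pose Phi z := \int[mu]_t f2 (vcons t z).
have mPhi : measurable_fun setT Phi.
  apply: (measurable_fun_fubini_tonelli_G (m1 := mu)
    (fun u => f2 (vcons u.1 u.2))) => //.
  exact: (measurableT_comp mf2 (mcons _)).
have Phi0 z : 0 <= Phi z by exact: integral_ge0.
transitivity (\int[leb n.+1]_z Phi (eps *: z)%R); last first.
  rewrite [RHS](integral_lebS_sym mf2 f2_ge0).
  case: eps1 => ->; first by under eq_integral do rewrite scale1r.
  by under eq_integral do rewrite scaleN1r; exact: integral_lebN mPhi Phi0.
rewrite [LHS](integral_lebS_sym mf1 f1_ge0).
apply: ge0_ae_eq_integral; first exact: measurableT.
- apply: (measurable_fun_fubini_tonelli_G (m1 := mu)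
  (fun u => f1 (vcons u.1 u.2))) => //.
  exact: (measurableT_comp mf1 (mcons _)).
- by apply: (measurableT_comp mPhi); exact: measurable_scalev.
- by move=> z _; apply: integral_ge0 => t _; exact: f1_ge0.
- by move=> z _; exact: Phi0.
exists [set 0%R]; split.
- exact: measurable_set0v.
- exact: leb_set0.
move=> z /=; apply: contra_notP => z0 _.
have {}z0 : (0 < enorm z)%R by rewrite enorm_gt0; apply/eqP.
pose g' t := g (vcons t (eps *: z)%R).
have mg' : measurable_fun setT g'.
  by apply: (measurableT_comp mg); exact: measurable_vcons.
(* For |p| < 1 these are cosh u and sinh u with p = tanh(u/2); for |p| > 1 the same holds with 1/p
   in place of p. *)
pose c := ((1 + p ^+ 2) / `|1 - p ^+ 2|)%R.
pose s := (2 * p / `|1 - p ^+ 2|)%R.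
have c0 : (0 < c)%R by rewrite divr_gt0// ltr_wpDr ?sqr_ge0.
have cs : (c ^+ 2 - s ^+ 2 = 1)%R.
  rewrite /c /s !exprMn -mulrBl exprVn real_normK ?num_real//.
  rewrite -[RHS](divff (expf_neq0 2 D0)); congr (_ / _)%R; ring.
transitivity (\int[mu]_t (g' (c * t + s * Num.sqrt (t ^+ 2 + enorm z ^+ 2))%R *
    (Num.sqrt (t ^+ 2 + enorm z ^+ 2))^-1%:E)).
  apply: eq_integral => t _; rewrite /f1 /g' boost_vcons enorm_vcons.
  by congr (g (vcons _ _) * _); rewrite /c /s; ring.
rewrite (integral_boost_line z0 c0 cs mg')//; last by move=> t; exact: g0.
by apply: eq_integral => t _; rewrite /f2 enorm_vcons enorm_eps.
Qed.

End boost.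

Section boost_invariance.
Context {R : realType}.
Local Open Scope ereal_scope.

(* Householder reflection along x - y. *)
Lemma orthogonal_move n (x y : 'cV[R]_n) : dot x x = dot y y ->
  exists2 Q : 'M[R]_n, (Q^T *m Q = 1%:M)%R & (Q *m x = y)%R.
Proof.
move=> xy; have [<-|xNy] := eqVneq x y.
  by exists 1%:M; rewrite ?trmx1 mul1mx.
pose u := (x - y)%R; pose k := (2 / dot u u)%R.
have u0 : (dot u u != 0)%R by rewrite dot_eq0 subr_eq0.
have uu : (u^T *m u = (dot u u)%:M)%R by rewrite [LHS]mx11_scalar.
exists (1%:M - k *: (u *m u^T))%R.
  have -> : ((1%:M - k *: (u *m u^T))^T = 1%:M - k *: (u *m u^T))%R.
    by rewrite [LHS]linearB/= trmx1 [X in (_ - X)%R]linearZ/= trmx_mul trmxK.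
  rewrite mulmxBl mul1mx mulmxBr mulmx1 -scalemxAl -scalemxAr scalerA.
  rewrite mulmxA -(mulmxA u) uu -mulmxA mul_scalar_mx -scalemxAr scalerA.
  have -> : (k * k * dot u u = k + k)%R by rewrite /k; field.
  by rewrite scalerDl opprB addrK subrK.
rewrite mulmxBl mul1mx -scalemxAl -mulmxA.
have -> : (u^T *m x = (dot u x)%:M)%R by rewrite [LHS]mx11_scalar.
rewrite mul_mx_scalar scalerA.
have -> : (k * dot u x = 1)%R.
  have uuE : (dot u u = 2 * dot u x)%R.
    by rewrite /u !(dotDl, dotDr, dotNl, dotNr) -xy (dotC y x); ring.
  move: u0; rewrite /k uuE => u0; field.
  by move: u0; rewrite mulf_eq0 negb_or pnatr_eq0.
by rewrite scale1r /u opprB addrC subrK.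
Qed.

Lemma boost_mulmx n (Q : 'M[R]_n) (psi x : 'cV[R]_n) : (Q^T *m Q = 1%:M)%R ->
  boost (Q *m psi) (Q *m x) = (Q *m boost psi x)%R.
Proof.
move=> QQ; rewrite /boost !dot_mulmx// enorm_mulmx//.
by rewrite -scalemxAr mulmxDr -!scalemxAr.
Qed.

(** An orthogonal matrix carrying [psi] to the first axis conjugates the boost to the case already
    treated, and it preserves both volume and |x|. *)
Lemma integral_boost n (psi : 'cV[R]_n.+2) (g : 'cV[R]_n.+2 -> \bar R) :
  (dot psi psi != 1)%R ->
  measurable_fun setT g -> (forall x, 0 <= g x) ->
  \int[leb n.+2]_x (g (boost psi x) * (enorm x)^-1%:E) =
  \int[leb n.+2]_x (g x * (enorm x)^-1%:E).
Proof.
move=> psi1 mg g0.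
have inv_ge0 (x : 'cV[R]_n.+2) : 0 <= (enorm x)^-1%:E.
  by rewrite lee_fin invr_ge0 enorm_ge0.
have minv : measurable_fun setT (fun x : 'cV[R]_n.+2 => (enorm x)^-1%:E).
  by apply/measurable_EFinP/measurable_invr; exact: measurable_enorm.
have e1 : dot (vcons (enorm psi) (0%R : 'cV[R]_n.+1)) (vcons (enorm psi) 0%R)
  = dot psi psi.
  by rewrite dot_vcons dot0l addr0 -expr2 enorm_sqr.
have [Q QQ Qpsi] := orthogonal_move (esym e1).
have QQ' : (Q *m Q^T = 1%:M)%R by exact: mulmx1C.
have mgQ : measurable_fun setT (fun x => g (Q^T *m x)%R).
  by apply: (measurableT_comp mg); exact: measurable_mulmx.
pose G x := g (Q^T *m boost (vcons (enorm psi) 0%R) x)%R * (enorm x)^-1%:E.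
have mG : measurable_fun setT G.
  by apply: (emeasurable_funM _ minv); exact: (measurableT_comp mgQ
    (measurable_boost _)).
have G0 x : 0 <= G x by rewrite mule_ge0.
transitivity (\int[leb n.+2]_x G (Q *m x)%R).
  apply: eq_integral => x _; rewrite /G enorm_mulmx// -Qpsi boost_mulmx//.
  by rewrite mulmxA QQ mul1mx.
rewrite (integral_leb_orthogonal QQ mG G0).
rewrite (@integral_boost_e1 _ _ _ (fun x => g (Q^T *m x)%R))//; last first.
  by rewrite enorm_sqr.
have mF : measurable_fun setT (fun x => g x * (enorm x)^-1%:E).
  exact: (emeasurable_funM mg minv).
have Q'Q' : (Q^T^T *m Q^T = 1%:M)%R by rewrite trmxK.
rewrite -(integral_leb_orthogonal Q'Q' mF); last by move=> x; rewrite mule_ge0.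
by apply: eq_integral => x _; rewrite (enorm_mulmx _ Q'Q').
Qed.

End boost_invariance.

(** * Area of the sphere *)

Section sphere_area.
Context {R : realType}.
Local Open Scope ereal_scope.
Local Notation mu := (@lebesgue_measure R).

Lemma measurable_expR_dot n :
  measurable_fun setT (fun x : 'cV[R]_n => (expR (- dot x x))%:E).
Proof.
apply/measurable_EFinP; apply: (measurableT_comp (f := @expR R)).
  exact: measurable_expR.
by apply: measurable_funN; exact: measurable_dot.
Qed.

Lemma integral_leb_gauss n :
  \int[leb n]_x (expR (- dot x x))%:E = (Num.sqrt (pi : R) ^+ n)%:E.
Proof.
elim: n => [|n IH].
  have -> : \int[@leb R 0]_x (expR (- dot x x))%:E = \int[@leb R 0]_x (cst 1 x).
    apply: eq_integral => x _; rewrite (_ : x = 0%R); last by apply/colP => -[].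
    by rewrite dot0l oppr0 expR0.
  by rewrite integral_cst//= lebE /= diracE mem_set// mule1 expr0.
rewrite (integral_lebS (@measurable_expR_dot n.+1)); last by move=> x;
  rewrite lee_fin expR_ge0.
rewrite (eq_integral (fun a : measurableTypeR R => (gauss_fun a)%:E * (Num.sqrt
  (pi : R) ^+ n)%:E)).
  rewrite ge0_integralZr//; last 2 first.
  - by apply/measurable_EFinP; exact: measurable_gauss_fun.
  - by move=> a _; rewrite lee_fin gauss_fun_ge0.
  by rewrite integralT_gauss -EFinM exprS.
move=> a _; rewrite -IH -ge0_integralZl//.
- by apply: eq_integral => z _; rewrite dot_vcons opprD expRD EFinM /gauss_fun
  expr2.
- exact: measurable_expR_dot.
- by rewrite lee_fin gauss_fun_ge0.
Qed.

Section dim.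
Variable d : nat.
Local Notation n := d.+2.
Local Notation leb := (@leb R n).
Local Notation surf := (@surf R d.+1).
Local Notation radial := (@radial R d.+1).

Let S := fine (surf setT).

Let S0 : (0 < S)%R.
Proof. by rewrite fine_gt0// surfT_gt0 surf_lty. Qed.

(** The density of [radial]: the mass of ]-oo, b] is (S / n) b^(n/2) for b > 0, with derivative (S /
    2) b^((n - 2)/2), and n - 2 = d here. *)
Let w (u : measurableTypeR R) : R :=
  ((S / 2 * Num.sqrt u ^+ d) * \1_(`]0%R, +oo[%classic) u)%R.

Let mw : measurable_fun setT w.
Proof.
apply: measurable_funM; last by apply: measurable_indic; exact: measurable_itv.
by apply: measurable_funM => //; apply: measurable_funX; exact: measurable_sqrt.
Qed.

Let w0 u : (0 <= w u)%R.
Proof. by rewrite !mulr_ge0// ?exprn_ge0 ?sqrtr_ge0 ?divr_ge0 ?(ltW S0). Qed.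

Let integral_sqrtX (b : R) : (0 < b)%R ->
  \int[mu]_(u in `[0%R, b]) (Num.sqrt u ^+ d)%:E = (2 / n%:R * Num.sqrt b ^+
    n)%:E.
Proof.
move=> b0.
have cs k : continuous (fun u : R => Num.sqrt u ^+ k)%R.
  move=> u; apply: (continuous_comp (f := @Num.sqrt R)
    (g := fun v : R => (v ^+ k)%R)); first exact: sqrt_continuous.
  exact: exprn_continuous.
have dF (u : R) : (0 < u)%R ->
    is_derive u 1%R (fun u => 2 / n%:R * Num.sqrt u ^+ n)%R (Num.sqrt u ^+ d)%R.
  move=> u0; have ds := is_derive1_sqrt u0; have su0 : (0 < Num.sqrt u)%R by
    rewrite sqrtr_gt0.
  have dX : is_derive (Num.sqrt u) 1%R (fun v : R => v ^+ n)%R (n%:R * Num.sqrt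
    u ^+ d.+1)%R.
    rewrite (_ : (fun v : R => v ^+ n)%R = (@idfun R ^+ n)%R); last first.
      by apply/funext => v; rewrite exprfctE.
    apply: (is_derive_eq (is_deriveX n (is_derive_id (Num.sqrt u) 1%R))).
    by rewrite /GRing.scale/= mulr1.
  have dS := @is_derive1_comp R (fun v : R => v ^+ n)%R Num.sqrt u _ _ dX ds.
  rewrite (_ : (fun u => _) = ((2 / n%:R) *: ((fun v : R => v ^+ n)
    \o Num.sqrt))%R)//.
  apply: (is_derive_eq (is_deriveZ (2 / n%:R)%R dS)).
  rewrite /GRing.scale/= exprS; field.
  by rewrite gt_eqF// -natrD pnatr_eq0.
rewrite (continuous_FTC2 (F := fun u => (2 / n%:R * Num.sqrt u ^+ n)%R) b0).
- by rewrite sqrtr0 expr0n/= mulr0 sube0.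
- exact/continuous_subspaceT/cs.
- split.
  + by move=> u; rewrite in_itv/= => /andP[u0 _]; case: (dF u u0).
  + by apply: cvg_at_right_filter; apply: cvgM; [exact: cvg_cst|exact: cs].
  + by apply: cvg_at_left_filter; apply: cvgM; [exact: cvg_cst|exact: cs].
- by move=> u; rewrite in_itv/= => /andP[u0 _]; rewrite derive1E;
  case: (dF u u0).
Qed.

Let mw_E (A : set (measurableTypeR R)) : measurable_fun A (fun u => (w u)%:E).
Proof. by apply: measurable_funTS; exact/measurable_EFinP. Qed.

Let radial_density (B : set (measurableTypeR R)) : measurable B ->
  radial B = \int[mu]_(u in B) (w u)%:E.
Proof.
have [D DE] := density_measure_ex mu mw w0.
move=> mB; rewrite -DE; move: B mB.
have n0 : (n%:R != 0 :> R)%R by rewrite pnatr_eq0.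
have lebE : leb (cone setT) = (S / n%:R)%:E.
  rewrite EFinM fine_surfK// surf_cone muleAC -EFinM divff// mul1e//.
have radialb (b : R) : radial `]-oo, b]%classic = (S / n%:R * Num.sqrt b ^+
  n)%:E.
  by rewrite radialE leb_fcone_le// lebE -EFinM mulrC.
apply: (@measureR_unique_cdf R) => b; first by rewrite /= radialb ltry.
rewrite /= radialb DE; have [b0|b0] := leP b 0%R.
  rewrite ler0_sqrtr// expr0n mulr0 integral0_eq// => u /=;
    rewrite in_itv/= => ub.
  by rewrite /w indicE memNset ?mulr0//= in_itv/= andbT; apply/negP;
    rewrite -leNgt (le_trans ub).
rewrite (_ : `]-oo, b]%classic = `]-oo, 0%R]%classic `|` `]0%R, b]%classic);
  last first.
  by rewrite -itv_bndbnd_setU// bnd_simp ltW.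
rewrite ge0_integral_setU//; last 2 first.
- by move=> u _; rewrite lee_fin.
- rewrite disj_set2E; apply/eqP/seteqP; split => // u [] /=.
  by rewrite !in_itv/= => u1 /andP[u2 _]; move: u2; rewrite ltNge u1.
rewrite integral0_eq ?add0e; last first.
  move=> u /=; rewrite in_itv/= => ub.
  by rewrite /w indicE memNset ?mulr0//= in_itv/= andbT; apply/negP;
    rewrite -leNgt.
rewrite (eq_integral (fun u : measurableTypeR R => (S / 2)%:E * (Num.sqrt u ^+
  d)%:E)); last first.
  move=> u /set_mem/=; rewrite in_itv/= => /andP[u0 _].
  by rewrite /w indicE mem_set ?mulr1 ?EFinM//= in_itv/= u0.
have ms (A : set R) : measurable_fun A (fun u : R => (Num.sqrt u ^+ d)%:E).
  apply: measurable_funTS; apply/measurable_EFinP; apply: measurable_funX.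
  exact: measurable_sqrt.
rewrite ge0_integralZl//; last 2 first.
- exact: ms.
- by rewrite lee_fin divr_ge0// ltW.
rewrite integral_itv_obnd_cbnd// integral_sqrtX// -EFinM; congr EFin.
by field; rewrite -natrD pnatr_eq0.
Qed.

(** The integral of exp(-|x|^2) computed twice: coordinate by coordinate, and through the
    distribution of |x|^2. *)
Let gamma_integral :
  (S / 2)%:E * \int[mu]_(t in `]0%R, +oo[) (Num.sqrt t ^+ d * expR (- t))%:E =
  (Num.sqrt (pi : R) ^+ n)%:E.
Proof.
rewrite -(integral_leb_gauss n).
have mexp : measurable_fun setT (fun u : measurableTypeR R => (expR (- u))%:E).
  apply/measurable_EFinP; apply: (measurableT_comp (f := @expR R)).
    exact: measurable_expR.
  exact: measurable_funN.
have mp : measurable_fun setT (fun t : measurableTypeR R => (Num.sqrt t ^+ d *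
  expR (- t))%:E).
  apply/measurable_EFinP; apply: measurable_funM; last exact/measurable_EFinP.
  by apply: measurable_funX; exact: measurable_sqrt.
transitivity (\int[radial]_u (expR (- u))%:E).
  rewrite (@integral_transfer _ _ _ _ R mu radial idfun w)//;
    last exact: measurable_id.
  rewrite [in LHS]integral_mkcond epatch_indic -[LHS]ge0_integralZl//.
  - by apply: eq_integral => u _ /=; rewrite /w -!EFinM; congr EFin; ring.
  - apply: emeasurable_funM => //; apply: measurable_EFin_indic.
    exact: measurable_itv.
  - by move=> u _; rewrite mule_ge0// lee_fin// mulr_ge0// ?expR_ge0//
    exprn_ge0// sqrtr_ge0.
  - by rewrite lee_fin divr_ge0// ltW.
rewrite (@integral_transfer _ _ _ _ R leb radial (@sqn R d.+1)
  (\1_[set x : 'cV[R]_n | x != 0%R]))//.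
- apply: ge0_ae_eq_integral; first exact: measurableT.
  + apply: emeasurable_funM; first exact: (measurableT_comp mexp
    (measurable_sqn (d := d.+1))).
    by apply: measurable_EFin_indic; exact: measurable_neq0.
  + exact: measurable_expR_dot.
  + by move=> x _; rewrite mule_ge0// lee_fin// expR_ge0.
  + by move=> x _; rewrite lee_fin expR_ge0.
  exists [set 0%R]; split.
  + exact: measurable_set0v.
  + exact: leb_set0.
  + move=> x /=; apply: contra_notP => /eqP x0 _.
    by rewrite indicE mem_set// mule1.
- exact: measurable_sqn.
- by apply: measurable_indic; exact: measurable_neq0.
- move=> A mA; rewrite [LHS]radialE [RHS]integral_mkcond epatch_indic.
  rewrite (measure_indic leb); last first.
    apply: measurableI; last exact: measurable_sqn_preimage.
    exact: measurable_fcone.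
  apply: eq_integral => x _; rewrite indicI/= EFinM; congr (_%:E * _).
  by rewrite /fcone preimage_setT setIT.
Qed.

Lemma surf_Gamma : S = (2 * pi `^ (n%:R / 2) / Gamma (n%:R / 2 : R))%R.
Proof.
have gE : \int[mu]_(t in `]0%R, +oo[) (Num.sqrt t ^+ d * expR (- t))%:E =
    (2 * Num.sqrt (pi : R) ^+ n / S)%:E.
  have S2 : ((S / 2)^-1 * (S / 2) = 1)%R by rewrite mulVf// gt_eqF// divr_gt0.
  move: gamma_integral => /(congr1 (fun z => (S / 2)^-1%:E * z)).
  rewrite muleA -EFinM S2 mul1e => ->; rewrite -EFinM; congr EFin; field.
  by rewrite gt_eqF.
have GE : Gamma (n%:R / 2 : R) = (2 * Num.sqrt (pi : R) ^+ n / S)%R.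
  rewrite /Gamma /Rintegral -[RHS]/(fine (_%:E)) -gE; congr fine.
  apply: eq_integral => t /set_mem/=; rewrite in_itv/= andbT => t0.
  rewrite -powR12_sqrt ?(ltW t0)// -powR_mulrn ?powR_ge0// -powRrM.
  by congr ((_ `^ _ * _)%:E); rewrite -[n%:R]/(d.+2)%:R -addn2 natrD; field.
rewrite GE -powR12_sqrt ?pi_ge0// -powR_mulrn ?powR_ge0// -powRrM mulrC.
have -> : (2^-1 * n%:R = n%:R / 2 :> R)%R by rewrite mulrC.
have p0 : (0 < (pi : R) `^ (n%:R / 2))%R by rewrite powR_gt0// pi_gt0.
by field; rewrite !gt_eqF.
Qed.

End dim.
End sphere_area.

(** * Moebius maps of the sphere *)

Section sphere_mobius.
Context {R : realType} {n : nat}.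
Implicit Types psi x y : 'cV[R]_n.

(* [mobius 1 psi] on the sphere: minus the second intersection of the sphere
   with the line through y and - psi. *)
Definition chord_map psi y : 'cV[R]_n :=
  ((1 - dot psi psi) / dot (y + psi) (y + psi)) *: (y + psi) + psi.

(** The factor rho by which the boost multiplies the norm in the direction y; its inverse is the
    conformal factor of [chord_map] on the sphere. *)
Definition chord_factor psi y : R :=
  dot (y + psi) (y + psi) / `|1 - dot psi psi|.

Lemma measurable_chord_map psi : measurable_fun setT (chord_map psi).
Proof.
apply: measurable_addv => //; apply: measurable_scalev;
  last exact: measurable_addv.
apply: measurable_funM => //; apply: measurable_invr.
by apply: measurable_dot; exact: measurable_addv.
Qed.

Lemma measurable_chord_factor psi : measurable_fun setT (chord_factor psi).
Proof. by apply: measurable_funM => //; apply: measurable_dot;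
  exact: measurable_addv. Qed.

Lemma chord_factor_ge0 psi y : 0 <= chord_factor psi y.
Proof. by rewrite divr_ge0// dot_ge0. Qed.

Lemma dot_sphere_neq0 psi y : dot psi psi != 1 -> dot y y = 1 ->
  dot (y + psi) (y + psi) != 0.
Proof.
move=> p1 y1; rewrite dot_eq0; apply: contraNneq p1 => /eqP.
by rewrite addrC addr_eq0 => /eqP ->; rewrite dotNl dotNr opprK y1.
Qed.

Lemma chord_factor_gt0 psi y : dot psi psi != 1 -> dot y y = 1 ->
  0 < chord_factor psi y.
Proof.
move=> p1 y1; rewrite divr_gt0// ?normr_gt0 ?subr_eq0 1?eq_sym//.
by rewrite lt0r dot_ge0 dot_sphere_neq0.
Qed.

Lemma dot_chord_map psi y : dot psi psi != 1 -> dot y y = 1 ->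
  dot (chord_map psi y) (chord_map psi y) = 1.
Proof.
move=> p1 y1; have := dot_sphere_neq0 p1 y1; rewrite /chord_map.
rewrite !(dotDl, dotDr, dotZl, dotZr) (dotC psi y) y1.
move: (dot psi psi) (dot y psi) => a b D0; field.
by apply: contraNneq D0 => <-; apply/eqP; ring.
Qed.

(** The link between the light cone and the sphere: length and direction of a boosted unit vector.
    Homogeneity ([boostZ]) extends it to every x. *)
Lemma boost_chord psi y : dot psi psi != 1 -> dot y y = 1 ->
  boost psi y = chord_factor psi y *: chord_map psi y.
Proof.
move=> p1 y1; have D0 := dot_sphere_neq0 p1 y1.
have n0 : `|1 - dot psi psi| != 0 by rewrite normr_eq0 subr_eq0 eq_sym.
have DE : dot (y + psi) (y + psi) = 1 + dot psi psi + 2 * dot y psi.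
  by rewrite !(dotDl, dotDr) (dotC psi y) y1; ring.
have en1 : enorm y = 1 by apply/enorm1_dot.
rewrite /boost /chord_map /chord_factor en1 [RHS]scalerDr [in RHS]scalerA.
have -> : dot (y + psi) (y + psi) / `|1 - dot psi psi| *
    ((1 - dot psi psi) / dot (y + psi) (y + psi)) =
    `|1 - dot psi psi|^-1 * (1 - dot psi psi).
  by field; rewrite n0 D0.
have factor (k a b : R) (u v : 'cV[R]_n) :
    (k^-1 * a) *: u + (b / k) *: v = k^-1 *: (a *: u + b *: v).
  by rewrite scalerDr !scalerA [b / k]mulrC.
rewrite factor; congr (_ *: _).
rewrite DE scalerDr -addrA -scalerDl; congr (_ + _ *: _); ring.
Qed.

Lemma boostZ k psi x : 0 <= k -> boost psi (k *: x) = k *: boost psi x.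
Proof.
move=> k0; rewrite /boost enormZ (ger0_norm k0) dotZl -mulrDr.
by rewrite !scalerDr !scalerA; congr (_ *: _ + _ *: _); ring.
Qed.

End sphere_mobius.

(** * Surface area under Moebius maps *)

Section surface_change_of_variables.
Context {R : realType} {d : nat}.
Local Open Scope ereal_scope.
Local Notation n := d.+2.
Local Notation V := 'cV[R]_n.
Local Notation leb := (@leb R n).
Local Notation surf := (@surf R d.+1).

Lemma dot_dir (x : V) : (x != 0)%R -> dot (dir x) (dir x) = 1%R.
Proof. by move=> x0; apply/enorm1_dot/enorm_dir. Qed.

(** [surf] is a measure on the whole space but is concentrated on the sphere: [integral_surf]
    evaluates integrands only at directions of nonzero vectors. *)
Lemma eq_integral_surf (f g : V -> \bar R) :
  measurable_fun setT f -> measurable_fun setT g ->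
  (forall y, 0 <= f y) -> (forall y, 0 <= g y) ->
  (forall y, dot y y = 1%R -> f y = g y) ->
  \int[surf]_y f y = \int[surf]_y g y.
Proof.
move=> mf mg f0 g0 fg; rewrite !integral_surf//; apply: eq_integral => x _.
have [->|x0] := eqVneq x 0%R.
  by rewrite indicE memNset ?mulr0 ?mule0// /pball/= enorm_gt0 eqxx.
by rewrite fg// dot_dir.
Qed.

Lemma measurable_rescaled_ball (rho : V -> R) :
  measurable_fun setT rho -> measurable (rescaled_ball rho).
Proof.
move=> mrho; rewrite (_ : rescaled_ball rho = [set x : V | x != 0%R] `&`
    (fun x => enorm x * rho (dir x))%R @^-1` `]-oo, 1%R]%classic).
  apply: measurableI; first exact: measurable_neq0.
  rewrite -[X in measurable X]setTI; apply: measurable_funM => //.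
    exact: measurable_enorm.
  exact: (measurableT_comp mrho measurable_dir).
by apply/seteqP; split => x; rewrite /rescaled_ball/= in_itv/=;
  [move=> /andP|move=> [-> ->]].
Qed.

(* Write surface area as the measure |x| dx / |x| on the punctured ball, boost,
   and rescale radially to get back to the punctured ball. *)
Lemma integral_surf_chord (psi : V) (g : V -> \bar R) :
  (dot psi psi != 1)%R -> measurable_fun setT g -> (forall y, 0 <= g y) ->
  \int[surf]_y (g (chord_map psi y) * (chord_factor psi y ^- d.+1)%:E) =
  \int[surf]_y g y.
Proof.
move=> p1 mg g0; set rho := chord_factor psi.
have mrho : measurable_fun setT rho by exact: measurable_chord_factor.
have rho0 y : (0 <= rho y)%R by exact: chord_factor_ge0.
have mI : measurable_fun setT (fun x : V => (n%:R * \1_pball x * enorm x)%:E).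
  apply/measurable_EFinP/measurable_funM; last exact: measurable_enorm.
  by apply: measurable_funM => //; apply: measurable_indic;
    exact: measurable_pball.
have mgd : measurable_fun setT (fun x : V => g (dir x)).
  exact: (measurableT_comp mg measurable_dir).
have mgc : measurable_fun setT (fun y => g (chord_map psi y)).
  exact: (measurableT_comp mg (measurable_chord_map _)).
pose G y := g (chord_map psi y) * (rho y ^- d.+1)%:E.
have mG : measurable_fun setT G.
  apply: emeasurable_funM => //; apply/measurable_EFinP/measurable_invr.
  exact: measurable_funX.
have G0 y : 0 <= G y by rewrite mule_ge0// lee_fin invr_ge0 exprn_ge0.
rewrite (integral_surf mG G0) (integral_surf mg g0).
(* The factor |x| is inserted so that integrating [F] against the boost-invariant measure dx / |x|
   gives the surface integral of [g]. *)
pose F x := g (dir x) * (n%:R * \1_pball x * enorm x)%:E.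
have mF : measurable_fun setT F by exact: emeasurable_funM.
have F0 x : 0 <= F x by rewrite mule_ge0// lee_fin !mulr_ge0// enorm_ge0.
transitivity (\int[leb]_x (n%:R%:E *
    ((\1_(rescaled_ball rho) x * rho (dir x) ^+ n)%:E * G (dir x)))).
  rewrite ge0_integralZl//.
  - rewrite integral_rescale//; last first.
      by move=> y /enorm1_dot y1; exact: chord_factor_gt0.
    rewrite -ge0_integralZl//.
    + by apply: eq_integral => x _; rewrite EFinM muleC -muleA.
    + apply: emeasurable_funM; last exact: (measurableT_comp mG measurable_dir).
      by apply: measurable_EFin_indic; exact: measurable_pball.
    + by move=> x _; rewrite mule_ge0// lee_fin.
  - apply: emeasurable_funM; last exact: (measurableT_comp mG measurable_dir).
    apply/measurable_EFinP/measurable_funM.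
      by apply: measurable_indic; exact: measurable_rescaled_ball.
    by apply: measurable_funX; exact: (measurableT_comp mrho measurable_dir).
  - by move=> x _; rewrite mule_ge0// lee_fin mulr_ge0// exprn_ge0.
transitivity (\int[leb]_x (F (boost psi x) * (enorm x)^-1%:E)).
  apply: eq_integral => x _.
  have [->|x0] := eqVneq x 0%R.
    rewrite (eqP (_ : enorm 0 == 0)%R) ?enorm_eq0// invr0 mule0.
    by rewrite [\1_(rescaled_ball rho) _]indicE memNset ?mul0r ?mul0e ?mule0//
      /rescaled_ball/= eqxx.
  have e0 : (0 < enorm x)%R by rewrite enorm_gt0.
  have y1 := dot_dir x0; have r0 : (0 < rho (dir x))%R by exact:
    chord_factor_gt0.
  have c1 := dot_chord_map p1 y1.
  have bE : (boost psi x = (enorm x * rho (dir x)) *: chord_map psi (dir x))%R.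
    rewrite -scalerA -boost_chord// -boostZ ?enorm_ge0//.
    by rewrite /dir scalerA divff ?scale1r// gt_eqF.
  have er0 : (0 < enorm x * rho (dir x))%R by rewrite mulr_gt0.
  have c1' : enorm (chord_map psi (dir x)) = 1%R by apply/enorm1_dot.
  rewrite /F bE dirZ// enormZ c1' mulr1 gtr0_norm//.
  have -> : dir (chord_map psi (dir x)) = chord_map psi (dir x).
    by rewrite {1}/dir c1' invr1 scale1r.
  have -> : \1_pball ((enorm x * rho (dir x)) *: chord_map psi (dir x))%R =
      \1_(rescaled_ball rho) x :> R.
    rewrite !indicE; congr (_%:R); congr nat_of_bool.
    by apply/idP/idP => /set_mem h; apply/mem_set; move: h;
      rewrite /pball/rescaled_ball/= enormZ c1' mulr1 gtr0_norm// er0 x0.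
  rewrite /G; move: (g _) (\1_(rescaled_ball rho) x : R) => t i.
  have comb (a b c : R) : a%:E * (b%:E * (t * c%:E)) = t * (a * b * c)%:E.
    by rewrite !EFinM muleA muleCA.
  (* Power count: rho^(d+2) from the rescaling times rho^-(d+1) from the weight leaves one rho, the
     ratio of the norms of [boost psi x] and x. *)
  rewrite comb -muleA -EFinM; congr (_ * _%:E); rewrite exprS; field.
  by rewrite expf_neq0 !gt_eqF.
rewrite (integral_boost p1 mF F0); apply: eq_integral => x _; rewrite /F.
have [->|x0] := eqVneq x 0%R.
  by rewrite indicE memNset ?mulr0 ?mul0r ?mule0 ?mul0e//
    /pball/= enorm_gt0 eqxx.
by rewrite -muleA -EFinM mulfK// enorm_eq0.
Qed.

End surface_change_of_variables.

(** * Moebius transformation of the Poisson kernel *)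

Section mobius_algebra.
Context {R : realType} {n : nat}.
Implicit Types (psi y z f : 'cV[R]_n) (phi : option 'cV[R]_n) (Q : 'M[R]_n).

Definition off_sphere phi : Prop :=
  if phi is Some f then dot f f != 1 else True.

(* The Cauchy density is poisson^d up to a constant; at infinity the value 1
   gives the uniform distribution. *)
Definition poisson phi y : R :=
  if phi is Some f then `|1 - dot f f| / dot (y - f) (y - f) else 1.

Lemma mobius_mulmx Q psi phi :
  mobius Q psi phi = omap (mulmx Q) (mobius 1%:M psi phi).
Proof.
case: phi => [f|]/=; last by case: einv => //= g; rewrite mul1mx.
by case: ifP => _; [|case: ifP => _]; rewrite /= ?mul1mx.
Qed.

Lemma poisson_mulmx Q phi y : Q^T *m Q = 1%:M ->
  poisson (omap (mulmx Q) phi) (Q *m y) = poisson phi y.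
Proof. by move=> QQ; case: phi => //= f; rewrite -mulmxBr !dot_mulmx. Qed.

Lemma off_sphere_mulmx Q phi : Q^T *m Q = 1%:M ->
  off_sphere phi -> off_sphere (omap (mulmx Q) phi).
Proof. by move=> QQ; case: phi => //= f; rewrite dot_mulmx. Qed.

Lemma dot_sub_sphere y f : dot f f != 1 -> dot y y = 1 -> dot (y - f) (y - f)
  != 0.
Proof. by move=> f1; apply: dot_sphere_neq0; rewrite dotNl dotNr opprK. Qed.

Section sphere_point.
Variables (psi y : 'cV[R]_n).
Hypotheses (psi1 : dot psi psi != 1) (y1 : dot y y = 1).
Let a := dot psi psi.
Let c := dot y psi.
Let D := 1 + a + 2 * c.

Let DE : dot (y + psi) (y + psi) = D.
Proof. by rewrite !(dotDl, dotDr) (dotC psi y) y1 /D /a /c; ring. Qed.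

Let D0 : D != 0. Proof. by rewrite -DE dot_sphere_neq0. Qed.

Let a1 : 1 - a != 0. Proof. by rewrite subr_eq0 eq_sym. Qed.

Let N0 : `|1 - a| != 0. Proof. by rewrite normr_eq0. Qed.

Let a1sq : (1 - a) ^+ 2 = `|1 - a| ^+ 2.
Proof. by rewrite real_normK ?num_real. Qed.

Let factorE : chord_factor psi y = D / `|1 - a|.
Proof. by rewrite /chord_factor DE. Qed.

Let chordE : chord_map psi y = ((1 - a) / D) *: (y + psi) + psi.
Proof. by rewrite /chord_map DE. Qed.

(** The kernel at infinity is 1, so the boost factor itself must be the kernel with pole psi /
    |psi|^2. For psi = 0 the pole stays at infinity and the factor is 1. *)
Let poisson_infty :
  off_sphere (mobius 1%:M psi None) /\
  chord_factor psi y = poisson (mobius 1%:M psi None) (chord_map psi y).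
Proof.
rewrite factorE chordE /= /einv; have [p0|p0] := eqVneq psi 0.
  by rewrite /= /D /a /c p0 dot0l dot0r !(addr0, mulr0) subr0 normr1 divr1.
have a0 : a != 0 by rewrite dot_eq0.
have ag0 : 0 < a by rewrite lt0r a0 dot_ge0.
rewrite /= mul1mx enorm_sqr -/a; split.
  by rewrite dotZl dotZr -/a mulVf// mulr1 invr_eq1.
have -> : `|1 - dot (a^-1 *: psi) (a^-1 *: psi)| = `|1 - a| / a.
  rewrite dotZl dotZr -/a (_ : 1 - _ = - ((1 - a) / a)); last by field.
  by rewrite normrN normrM [`|a^-1|]gtr0_norm// invr_gt0.
have -> : dot (((1 - a) / D) *: (y + psi) + psi - a^-1 *: psi)
    (((1 - a) / D) *: (y + psi) + psi - a^-1 *: psi) = (1 - a) ^+ 2 / (D * a).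
  rewrite !(dotDl, dotDr, dotZl, dotZr, dotNl, dotNr) (dotC psi y) y1 -/a -/c.
  by move: D0 a0; rewrite /D => D0' a0; field; rewrite a0 D0'.
by rewrite a1sq; field; rewrite D0 N0 a0.
Qed.

Lemma mobius_poisson phi : off_sphere phi ->
  off_sphere (mobius 1%:M psi phi) /\
  poisson phi y * chord_factor psi y =
  poisson (mobius 1%:M psi phi) (chord_map psi y).
Proof.
case: phi => [f f1|_]; last first.
  by rewrite [poisson None y]/= mul1r; exact: poisson_infty.
rewrite /=; have [->|f0] := eqVneq f 0.
  rewrite mul1mx /=; split => //.
  rewrite subr0 dot0l subr0 normr1 y1 divr1 mul1r factorE chordE addrK.
  rewrite dotZl dotZr DE -/a (_ : _ * (_ * D) = (1 - a) ^+ 2 / D);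
    last by field.
  by rewrite a1sq; field; rewrite D0 N0.
(* The pole f = -psi / |psi|^2 goes to infinity: its kernel must be exactly the inverse of the boost
   factor. *)
case: eqVneq => [|fE].
  rewrite /einv oppr_eq0; case: eqVneq => // p0 [fE]; split => //=.
  have a0 : a != 0 by rewrite dot_eq0.
  have ag0 : 0 < a by rewrite lt0r a0 dot_ge0.
  have {}fE : f = - (a^-1 *: psi).
    by rewrite fE enorm_sqr dotNl dotNr opprK scalerN.
  rewrite fE factorE !(dotNl, dotNr, opprK) dotZl dotZr -/a.
  have -> : `|1 - a^-1 * (a^-1 * a)| = `|1 - a| / a.
    rewrite (_ : 1 - _ = - ((1 - a) / a)); last by field.
    by rewrite normrN normrM [`|a^-1|]gtr0_norm// invr_gt0.
  rewrite !(dotDl, dotDr, dotZl, dotZr) (dotC psi y) y1 -/a -/c.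
  have -> : 1 + a^-1 * c + (a^-1 * c + a^-1 * (a^-1 * a)) = D / a.
    by rewrite /D; field.
  by field; rewrite D0 N0 a0.
pose t := dot f f; pose b := dot f psi; pose e := dot y f.
have t0 : t != 0 by rewrite dot_eq0.
have tg0 : 0 < t by rewrite lt0r t0 dot_ge0.
rewrite enorm_sqr -/t !enorm_sqr.
set ft := t^-1 *: f.
have E0 : dot (ft + psi) (ft + psi) != 0.
  rewrite dot_eq0; apply: contra_neq fE => /eqP; rewrite addr_eq0 => /eqP ftE.
  have ft0 : ft != 0 by rewrite scaler_eq0 invr_eq0 negb_or t0.
  rewrite /einv -ftE (negbTE ft0) enorm_sqr /ft dotZl dotZr -/t scalerA.
  by congr Some; rewrite -[LHS]scale1r; congr (_ *: _); field.
have tE : t * dot (ft + psi) (ft + psi) = 1 + 2 * b + a * t.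
  by rewrite /ft !(dotDl, dotDr, dotZl, dotZr) (dotC psi f) -/t -/b -/a; field.
have E0' : 1 + 2 * b + a * t != 0 by rewrite -tE mulf_neq0.
have {}tE : dot (ft + psi) (ft + psi) = (1 + 2 * b + a * t)
  / t by rewrite -tE mulrC mulKf.
(* This number is t |f/t + psi|^2. Its sign is needed to take it out of the absolute value in the
   kernel. *)
have Eg0 : 0 < 1 + 2 * b + a * t.
  by rewrite lt0r E0' /=; have := dot_ge0 (ft + psi);
    rewrite tE pmulr_lge0// invr_gt0.
set m := 1%:M *m _.
have mE : m = ((1 - a) * t / (1 + 2 * b + a * t)) *: (ft + psi) + psi.
  rewrite /m mul1mx tE -/a; congr (_ *: _ + _); field.
  by rewrite E0' t0.
have mm : 1 - dot m m = (1 - a) * (1 - t) / (1 + 2 * b + a * t).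
  rewrite mE /ft !(dotDl, dotDr, dotZl, dotZr) (dotC psi f) -/t -/b -/a; field.
  by rewrite E0' t0.
have t1 : 1 - t != 0 by rewrite subr_eq0 eq_sym.
split.
  by rewrite /= eq_sym -subr_eq0 mm !mulf_neq0// invr_eq0.
have yfE : dot (y - f) (y - f) = 1 + t - 2 * e.
  by rewrite !(dotDl, dotDr, dotNl, dotNr) (dotC f y) y1 -/t -/e; ring.
have W0 : 1 + t - 2 * e != 0 by rewrite -yfE dot_sub_sphere.
(* Both 1 - |m|^2 and this squared distance carry the denominator 1 + 2b + at, which cancels in the
   kernel; D / |1 - a| remains, the boost factor. *)
have zm : dot (chord_map psi y - m) (chord_map psi y - m) =
    (1 - a) ^+ 2 * (1 + t - 2 * e) / (D * (1 + 2 * b + a * t)).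
  rewrite chordE mE /ft !(dotDl, dotDr, dotZl, dotZr, dotNl, dotNr).
  rewrite (dotC psi f) (dotC psi y) (dotC f y) y1 -/t -/b -/a -/c -/e.
  by move: D0; rewrite /D => D0'; field; rewrite D0' E0' t0.
rewrite /= yfE mm zm factorE a1sq !normrM [`|_^-1|]gtr0_norm ?invr_gt0//.
by field; rewrite D0 N0 E0' W0.
Qed.

End sphere_point.
End mobius_algebra.

(** * Invariance of the spherical Cauchy family *)

Section spherical_cauchy_invariance.
Context {R : realType} {d : nat}.
Local Open Scope ereal_scope.
Local Notation n := d.+2.
Local Notation V := 'cV[R]_n.
Local Notation leb := (@leb R n).
Local Notation surf := (@surf R d.+1).
Implicit Types (psi y f : V) (phi : option V) (Q : 'M[R]_n).

Lemma integral_surf_orthogonal Q (g : V -> \bar R) : (Q^T *m Q = 1%:M)%R ->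
  measurable_fun setT g -> (forall y, 0 <= g y) ->
  \int[surf]_y g (Q *m y)%R = \int[surf]_y g y.
Proof.
move=> QQ mg g0.
have mgQ : measurable_fun setT (fun y => g (Q *m y)%R).
  by apply: (measurableT_comp mg); exact: measurable_mulmx.
rewrite !integral_surf//.
have mF : measurable_fun setT (fun x : V => g (dir x) * (n%:R * \1_pball x)%:E).
  apply: emeasurable_funM; first exact: (measurableT_comp mg measurable_dir).
  apply/measurable_EFinP/measurable_funM => //.
  by apply: measurable_indic; exact: measurable_pball.
rewrite -(integral_leb_orthogonal QQ mF); last first.
  by move=> x; rewrite mule_ge0// lee_fin mulr_ge0.
apply: eq_integral => x _.
have -> : dir (Q *m x)%R = (Q *m dir x)%R by rewrite /dir enorm_mulmx//
  scalemxAr.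
congr (_ * (_ * _)%:E); rewrite !indicE; congr (_%:R); congr nat_of_bool.
by apply/idP/idP => /set_mem h; apply/mem_set; move: h;
  rewrite /pball/= enorm_mulmx.
Qed.

Lemma surface_sphere : surface (@sphere R d.+1) = surf setT.
Proof.
rewrite surf_cone surface_cone cone_setT; congr (_ * leb _).
apply/seteqP; split => x; first by move=> [].
move=> x1; split => //; apply: enorm_dir.
by move: x1 => /andP[x0 _]; rewrite -enorm_gt0.
Qed.

Let S := fine (surf setT).

Let S0 : (0 < S)%R.
Proof. by rewrite fine_gt0// surfT_gt0 surf_lty. Qed.

Lemma measurable_poisson phi : measurable_fun setT (@poisson R n phi).
Proof.
case: phi => [f|] /=; last exact: measurable_cst.
apply: measurable_funM => //; apply: measurable_invr.
by apply: measurable_dot; exact: measurable_subv.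
Qed.

Lemma poisson_ge0 phi y : (0 <= poisson phi y)%R.
Proof. by case: phi => [f|] //=; rewrite divr_ge0// dot_ge0. Qed.

(** Normalizing by the total area [S] instead of the Gamma constant treats finite and infinite
    parameters alike; [surf_Gamma] identifies the two. *)
Definition cauchy_weight phi (A : set V) y : \bar R :=
  (S^-1 * poisson phi y ^+ d.+1)%:E * (\1_A y)%:E.

Lemma measurable_cauchy_weight phi A : measurable A ->
  measurable_fun setT (cauchy_weight phi A).
Proof.
move=> mA; apply: emeasurable_funM; last exact: measurable_EFin_indic.
apply/measurable_EFinP/measurable_funM => //.
by apply: measurable_funX; exact: measurable_poisson.
Qed.

Lemma cauchy_weight_ge0 phi A y : 0 <= cauchy_weight phi A y.
Proof.
by rewrite mule_ge0// lee_fin// mulr_ge0 ?invr_ge0 ?(ltW S0)//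
  exprn_ge0 ?poisson_ge0.
Qed.

Lemma spherical_cauchyE phi A : off_sphere phi -> measurable A ->
  spherical_cauchy phi A = \int[surf]_y cauchy_weight phi A y.
Proof.
move=> phi1 mA; case: phi phi1 => [f f1|_] /=.
  have -> : (enorm f == 1%R) = false by apply: contraNF f1 => /eqP/enorm1_dot
    ->.
  rewrite -surfE integral_mkcond epatch_indic; apply: eq_integral => y _ /=.
  congr (_%:E * _); rewrite /cauchy_density !enorm_sqr; congr (_ * _)%R.
  by rewrite /S surf_Gamma invf_div.
rewrite surface_sphere -/S -surfE muleC (measure_indic surf mA).
rewrite -ge0_integralZl//.
- by apply: eq_integral => y _; rewrite /cauchy_weight expr1n mulr1.
- exact: measurable_EFin_indic.
- by rewrite lee_fin invr_ge0 ltW.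
Qed.

(** The integral on the right is pulled back along Q and then along [chord_map]. The weight
    rho^-(d+1), for the sphere of dimension d+1 used here, turns the power of k(M y, M phi) = k(y,
    phi) rho(y) into that of k(y, phi). *)
Lemma spherical_cauchy_mobius Q psi phi A :
  (Q^T *m Q = 1%:M)%R -> (dot psi psi != 1)%R -> off_sphere phi -> measurable A
    ->
  spherical_cauchy phi ((fun y => Q *m chord_map psi y)%R @^-1` A) =
  spherical_cauchy (mobius Q psi phi) A.
Proof.
move=> QQ psi1 phi1 mA; set T := (fun y => _).
have mT : measurable_fun setT T.
  by apply: measurable_mulmx; exact: measurable_chord_map.
have mTA : measurable (T @^-1` A).
  by rewrite -[X in measurable X]setTI; exact: mT.
have off1 : off_sphere (mobius 1%:M psi phi).
  (* [mobius_poisson] is stated at a point of the sphere; any unit vector gives access to its first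
     claim. *)
  have [x x1] : exists x : V, dot x x = 1%R.
    exists (vcons 1%R 0%R); rewrite dot_vcons dot0l addr0 mulr1//.
  by have [] := mobius_poisson psi1 x1 phi1.
have offQ : off_sphere (mobius Q psi phi).
  by rewrite mobius_mulmx; exact: off_sphere_mulmx.
rewrite !spherical_cauchyE//.
have mW := measurable_cauchy_weight (mobius Q psi phi) mA.
have W0 := cauchy_weight_ge0 (mobius Q psi phi) A.
have mWQ : measurable_fun setT (fun y => cauchy_weight (mobius Q psi phi)
  A (Q *m y)%R).
  by apply: (measurableT_comp mW); exact: measurable_mulmx.
rewrite -(integral_surf_orthogonal QQ mW W0).
rewrite -(integral_surf_chord psi1 mWQ); last by move=> y; exact: W0.
apply: eq_integral_surf.
- exact: measurable_cauchy_weight.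
- apply: emeasurable_funM.
    exact: (measurableT_comp mWQ (measurable_chord_map _)).
  apply/measurable_EFinP/measurable_invr/measurable_funX.
  exact: measurable_chord_factor.
- by move=> y; exact: cauchy_weight_ge0.
- move=> y; rewrite mule_ge0 ?W0// lee_fin invr_ge0 exprn_ge0//.
  exact: chord_factor_ge0.
move=> y y1; rewrite /cauchy_weight mobius_mulmx poisson_mulmx//.
have [_ <-] := mobius_poisson psi1 y1 phi1.
have -> : \1_A (Q *m chord_map psi y)%R = \1_(T @^-1` A) y :> R.
  by rewrite !indicE; congr (_%:R); congr nat_of_bool;
    apply/idP/idP => /set_mem h; apply/mem_set.
rewrite -!EFinM; congr EFin; rewrite exprMn; field.
rewrite expf_neq0 ?gt_eqF//; first exact: chord_factor_gt0.
Qed.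

(** A unit vector avoids both exceptional points: the origin, and the pole -psi / |psi|^2, whose
    norm is 1 only if that of psi is. *)
Lemma mobius_sphere Q psi f : (dot psi psi != 1)%R -> dot f f = 1%R ->
  mobius Q psi (Some f) = Some (Q *m chord_map psi f)%R.
Proof.
move=> psi1 f1 /=; have [f0|f0] := eqVneq f 0%R.
  by move: f1; rewrite f0 dot0l => /eqP; rewrite eq_sym oner_eq0.
case: eqVneq => [|_].
  rewrite /einv oppr_eq0; case: eqVneq => // p0 [fE]; exfalso.
  have a0 : dot psi psi != 0%R by rewrite dot_eq0.
  move: f1 psi1; rewrite fE enorm_sqr dotZl dotZr !dotNl !dotNr !opprK.
  by rewrite mulVf// mulr1 => /eqP; rewrite invr_eq1 => ->.
by rewrite !enorm_sqr f1 invr1 scale1r.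
Qed.

End spherical_cauchy_invariance.

Theorem theorem3 (R : realType) (d : nat) (Q : 'M[R]_d.+1)
    (psi : 'cV[R]_d.+1) (phi : option 'cV[R]_d.+1)
    (dO : measure_display) (Omega : measurableType dO)
    (P : probability Omega R) (Y : Omega -> option 'cV[R]_d.+1)
    (hd : (1 <= d)%N) (hQ : rotation Q) (hpsi : ~ sphere psi) :
  follows_spherical_cauchy P Y phi ->
  follows_spherical_cauchy P (mobius Q psi \o Y) (mobius Q psi phi).
Proof.
(* From here the sphere has dimension [d.+1], matching the index shift of the preceding sections. *)
case: d hd Q psi phi Y hQ hpsi => // d _ Q psi phi Y [QQ _] psiS [X [YX XS XP]].
have psi1 : dot psi psi != 1 by apply/eqP => /enorm1_dot.
pose T (y : 'cV[R]_d.+2) := Q *m chord_map psi y.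
have mT : measurable_fun setT T.
  by apply: measurable_mulmx; exact: measurable_chord_map.
have mTX : measurable_fun setT (T \o X) by exact: measurableT_comp.
pose X' : {RV P >-> 'cV[R]_d.+2} :=
  HB.pack (T \o X) (isMeasurableFun.Build _ _ _ _ _ mTX).
have X1 w : dot (X w) (X w) = 1 by apply/enorm1_dot; exact: XS.
exists X'; split => [w|w|A mA].
- by rewrite /= YX mobius_sphere.
- by apply/enorm1_dot; rewrite /= dot_mulmx// dot_chord_map.
have mTA : measurable (T @^-1` A).
  by rewrite -[X in measurable X]setTI; exact: mT.
transitivity (spherical_cauchy phi (T @^-1` A)); first by rewrite -XP.
have [phi1|phiS] := pselect (off_sphere phi); first exact:
  spherical_cauchy_mobius.
(* Only a parameter on the sphere is left: the image of the point mass at f is the point mass at T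
   f. *)
case: phi phiS {XP} => [f fS|[]//].
have f1 : dot f f = 1 by apply: contra_notP fS => /eqP.
have Tf1 : dot (T f) (T f) = 1 by rewrite dot_mulmx// dot_chord_map.
rewrite (mobius_sphere Q psi1 f1) /spherical_cauchy.
have -> : enorm f == 1 by apply/eqP/enorm1_dot.
have -> : enorm (Q *m chord_map psi f) == 1 by apply/eqP/enorm1_dot.
by rewrite !diracE.
Qed.
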